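(* There exists $a\in[0,0.4076)$ such that for all $c\in(1,2)$ and all $\eta\in\left(0,\frac{2-(a+1)c}{3-a}\right)$ there is a constant $C=C(c,\eta)$ such that for all $N\geq 2$, \[ \frac 1N\left|\sum_{1\leq n\leq N}(-1)^{s_2(\lfloor n^c\rfloor)}\right|\leq C N^{-\eta}. \] In particular, for every $c$ with $1<c\leq 1.42$ there exist $\eta>\max\{0,(7-5c)/9\}$ and $C$ such that this estimate holds for all $N\geq 2$.
   Context: $s_2(n)$ denotes the sum of the binary digits of the nonnegative integer $n$ (so $(-1)^{s_2(n)}$ is the Thue–Morse sequence); $\lfloor\cdot\rfloor$ is the floor function. *)

(* Defs.v *)
From Stdlib Require Import Reals ZArith PArith NArith.
Open Scope R_scope.

Fixpoint popcount_pos (p : positive) : nat :=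
  match p with
  | xH => 1%nat
  | xO q => popcount_pos q
  | xI q => S (popcount_pos q)
  end.

Definition s2 (n : nat) : nat :=
  match N.of_nat n with
  | N0 => 0%nat
  | Npos p => popcount_pos p
  end.

(* floor of a real number, as a natural number (truncated at 0;
   only applied to nonnegative reals here). Int_part x = floor x. *)
Definition floor_nat (x : R) : nat := Z.to_nat (Int_part x).

Definition tm_term (c : R) (n : nat) : R :=
  (-1) ^ (s2 (floor_nat (Rpower (INR n) c))).

Fixpoint tm_sum (c : R) (N : nat) : R :=
  match N with
  | O => 0
  | S m => tm_sum c m + tm_term c (S m)
  end.

(* Main.v *)
(** Thue-Morse is (-1)^s2 and [n^c] is, on a block of [K = N^kappa] consecutive
    integers, linear up to an error of size [K^2 N^(c-2)]. The values [floor (n^c)]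
    of one block meet at most two dyadic intervals of length [2^la ~ K N^(c-1)], and
    on each of them the sign is a constant times a function of [floor (n^c) mod 2^la].
    That function of [x = n^c] is approximated by its Fejer means, a trigonometric
    polynomial with frequencies [t / 2^la] of modulus below [2^mu ~ N^(2-c) / K^2]
    whose coefficients are dominated by those of Thue-Morse, the products
    [prod_(i < la) |sin (pi 2^i t / 2^la)|], times [1 / (1 + |t| / 2^la)]; the error
    lives near the integers and is itself dominated by Fejer kernels. The exponential
    sum over a block is [O (min (K, 1 / ||xi f'||))], and the numbers [xi f'] attached
    to the successive blocks are well spaced, so that the sum over all blocks is
    [O ((N / K) log N)] uniformly in the frequency [xi], unless [xi < N^(1-c)], where the
    products are smaller than any power of [N]. The L1 norm of the products is [O (rho^la)]
    with [rho = 1.325], and [a = log2 rho < 0.4076]. With [K^2 N^(c-2) = N^(-eta)] both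
    errors balance exactly at [eta = (2 - (a + 1) c) / (3 - a)]. *)

Require Import Defs.
From Stdlib Require Import Reals Lra Lia Psatz ZArith Arith.
From Coquelicot Require Import Coquelicot.
Open Scope R_scope.

(** * Finite sums and additive characters *)

(** The sign is smoothed as one function of [x] modulo [2^la], not residue class by residue class,
    so that a single L1 norm, that of the Thue-Morse products, has to be paid. Sampling it at
    [2^la * 2^mu] points keeps everything finite: interpolation and partition of unity are
    identities between finite sums, and each Fourier coefficient factors exactly into a Thue-Morse
    product and a geometric sum over one unit interval of the grid. Main term and smoothing error
    then rest on the same exponential sums, at the frequencies [(j - k) / 2^la] for the former and
    at positive integers below [2^mu] for the latter. The place where a block crosses a multiple of
    [2^la] is not controlled, hence the estimates on a block are made for all of its subintervals. A
    single block can be resonant, its slope being close to an integer, and nothing is gained there.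
    Therefore absolute values are taken for each frequency and each block, and the blocks are added
    at fixed frequency: spacing of the slopes makes resonant blocks rare. *)

Fixpoint sumR (f : nat -> R) (n : nat) : R :=
  match n with O => 0 | S m => sumR f m + f m end.

Fixpoint sumC (f : nat -> C) (n : nat) : C :=
  match n with O => RtoC 0 | S m => (sumC f m + f m)%C end.

Lemma sumR_ext (f g : nat -> R) (n : nat) :
  (forall i, (i < n)%nat -> f i = g i) -> sumR f n = sumR g n.
Proof.
  induction n as [|n IH]; simpl; intros H; [reflexivity|].
  rewrite IH, (H n); [reflexivity|lia|intros; apply H; lia].
Qed.

Lemma sumR_le (f g : nat -> R) (n : nat) :
  (forall i, (i < n)%nat -> f i <= g i) -> sumR f n <= sumR g n.
Proof.
  induction n as [|n IH]; simpl; intros H; [lra|].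
  apply Rplus_le_compat; [apply IH; intros; apply H; lia|apply H; lia].
Qed.

Lemma sumR_plus (f g : nat -> R) (n : nat) :
  sumR (fun i => f i + g i) n = sumR f n + sumR g n.
Proof. induction n as [|n IH]; simpl; [lra|rewrite IH; lra]. Qed.

Lemma sumR_scal (a : R) (f : nat -> R) (n : nat) :
  sumR (fun i => a * f i) n = a * sumR f n.
Proof. induction n as [|n IH]; simpl; [lra|rewrite IH; lra]. Qed.

Lemma sumR_const (a : R) (n : nat) : sumR (fun _ => a) n = INR n * a.
Proof. induction n as [|n IH]; [simpl; lra|rewrite S_INR; simpl; rewrite IH; lra]. Qed.

Lemma sumR_ge0 (f : nat -> R) (n : nat) :
  (forall i, (i < n)%nat -> 0 <= f i) -> 0 <= sumR f n.
Proof.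
  intros H. replace 0 with (sumR (fun _ => 0) n) by (rewrite sumR_const; lra).
  now apply sumR_le.
Qed.

Lemma sumR_bound (f : nat -> R) (a : R) (n : nat) :
  (forall i, (i < n)%nat -> f i <= a) -> sumR f n <= INR n * a.
Proof. intros H. rewrite <- sumR_const. now apply sumR_le. Qed.

Lemma sumR_swap (f : nat -> nat -> R) (m n : nat) :
  sumR (fun i => sumR (fun j => f i j) n) m = sumR (fun j => sumR (fun i => f i j) m) n.
Proof.
  induction m as [|m IH]; simpl.
  - rewrite sumR_const; lra.
  - rewrite IH, <- sumR_plus. reflexivity.
Qed.

Lemma sumR_app (f : nat -> R) (m n : nat) :
  sumR f (m + n) = sumR f m + sumR (fun i => f (m + i)%nat) n.
Proof.
  induction n as [|n IH]; simpl.
  - rewrite Nat.add_0_r; lra.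
  - rewrite Nat.add_succ_r; simpl; rewrite IH; lra.
Qed.

Lemma sumR_block (f : nat -> R) (m k : nat) :
  sumR f (m * k) = sumR (fun j => sumR (fun r => f (j * k + r)%nat) k) m.
Proof.
  induction m as [|m IH]; simpl; [reflexivity|].
  rewrite Nat.add_comm, sumR_app, IH. reflexivity.
Qed.

Lemma sumR_mono (f : nat -> R) (m n : nat) :
  (m <= n)%nat -> (forall i, (i < n)%nat -> 0 <= f i) -> sumR f m <= sumR f n.
Proof.
  intros Hmn H. replace n with (m + (n - m))%nat by lia. rewrite sumR_app.
  assert (0 <= sumR (fun i => f (m + i)%nat) (n - m)); [|lra].
  apply sumR_ge0. intros; apply H; lia.
Qed.

Lemma sumR_term_le (f : nat -> R) (n i : nat) :
  (i < n)%nat -> (forall j, (j < n)%nat -> 0 <= f j) -> f i <= sumR f n.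
Proof.
  intros Hi H. apply Rle_trans with (sumR f (S i)).
  - simpl. assert (0 <= sumR f i); [apply sumR_ge0; intros; apply H; lia|lra].
  - apply sumR_mono; [lia|exact H].
Qed.

Lemma sumR_Rabs (f : nat -> R) (n : nat) :
  Rabs (sumR f n) <= sumR (fun i => Rabs (f i)) n.
Proof.
  induction n as [|n IH]; simpl; [rewrite Rabs_R0; lra|].
  eapply Rle_trans; [apply Rabs_triang|lra].
Qed.

Lemma sumC_ext (f g : nat -> C) (n : nat) :
  (forall i, (i < n)%nat -> f i = g i) -> sumC f n = sumC g n.
Proof.
  induction n as [|n IH]; simpl; intros H; [reflexivity|].
  rewrite IH, (H n); [reflexivity|lia|intros; apply H; lia].
Qed.

Lemma sumC_plus (f g : nat -> C) (n : nat) :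
  sumC (fun i => f i + g i)%C n = (sumC f n + sumC g n)%C.
Proof. induction n as [|n IH]; simpl; [ring|rewrite IH; ring]. Qed.

Lemma sumC_scal (a : C) (f : nat -> C) (n : nat) :
  sumC (fun i => a * f i)%C n = (a * sumC f n)%C.
Proof. induction n as [|n IH]; simpl; [ring|rewrite IH; ring]. Qed.

Lemma sumC_zero (n : nat) : sumC (fun _ => RtoC 0) n = RtoC 0.
Proof. induction n as [|n IH]; simpl; [reflexivity|rewrite IH; ring]. Qed.

Lemma sumC_swap (f : nat -> nat -> C) (m n : nat) :
  sumC (fun i => sumC (fun j => f i j) n) m = sumC (fun j => sumC (fun i => f i j) m) n.
Proof.
  induction m as [|m IH]; simpl.
  - rewrite sumC_zero; reflexivity.
  - rewrite IH, <- sumC_plus. reflexivity.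
Qed.

Lemma sumC_app (f : nat -> C) (m n : nat) :
  sumC f (m + n) = (sumC f m + sumC (fun i => f (m + i)%nat) n)%C.
Proof.
  induction n as [|n IH]; simpl.
  - rewrite Nat.add_0_r; ring.
  - rewrite Nat.add_succ_r; simpl; rewrite IH; ring.
Qed.

Lemma sumC_block (f : nat -> C) (m k : nat) :
  sumC f (m * k) = sumC (fun j => sumC (fun r => f (j * k + r)%nat) k) m.
Proof.
  induction m as [|m IH]; simpl; [reflexivity|].
  rewrite Nat.add_comm, sumC_app, IH. reflexivity.
Qed.

Lemma sumC_Cmod (f : nat -> C) (n : nat) :
  Cmod (sumC f n) <= sumR (fun i => Cmod (f i)) n.
Proof.
  induction n as [|n IH]; simpl; [rewrite Cmod_0; lra|].
  eapply Rle_trans; [apply Cmod_triangle|lra].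
Qed.

Lemma sumC_conj (f : nat -> C) (n : nat) :
  Cconj (sumC f n) = sumC (fun i => Cconj (f i)) n.
Proof.
  induction n as [|n IH]; simpl.
  - unfold Cconj, RtoC; simpl; f_equal; lra.
  - rewrite Cplus_conj, IH. reflexivity.
Qed.

Lemma sumC_RtoC (f : nat -> R) (n : nat) :
  sumC (fun i => RtoC (f i)) n = RtoC (sumR f n).
Proof. induction n as [|n IH]; simpl; [reflexivity|rewrite IH, RtoC_plus; reflexivity]. Qed.

(** * The additive character and geometric sums *)

Definition e (x : R) : C := (cos (2 * PI * x), sin (2 * PI * x)).

Lemma e_add (x y : R) : e (x + y) = (e x * e y)%C.
Proof.
  unfold e, Cmult; simpl.
  rewrite Rmult_plus_distr_l, cos_plus, sin_plus. f_equal; ring.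
Qed.

Lemma e_0 : e 0 = RtoC 1.
Proof. unfold e. rewrite Rmult_0_r, cos_0, sin_0. reflexivity. Qed.

Lemma e_opp (x : R) : e (- x) = Cconj (e x).
Proof.
  unfold e, Cconj; simpl. replace (2 * PI * - x) with (- (2 * PI * x)) by ring.
  rewrite cos_neg, sin_neg. reflexivity.
Qed.

Lemma Cmod_e (x : R) : Cmod (e x) = 1.
Proof.
  unfold Cmod, e; simpl fst; simpl snd. rewrite <- sqrt_1. f_equal.
  pose proof (sin2_cos2 (2 * PI * x)) as H. unfold Rsqr in H. lra.
Qed.

Lemma e_INR (n : nat) : e (INR n) = RtoC 1.
Proof.
  induction n as [|n IH]; [apply e_0|].
  rewrite S_INR, e_add, IH. unfold e. rewrite Rmult_1_r, cos_2PI, sin_2PI.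
  unfold Cmult, RtoC; simpl; f_equal; ring.
Qed.

Lemma e_add_INR (x : R) (n : nat) : e (x + INR n) = e x.
Proof. rewrite e_add, e_INR. ring. Qed.

Lemma e_sub_INR (x : R) (n : nat) : e (x - INR n) = e x.
Proof. rewrite <- (e_add_INR (x - INR n) n). f_equal; ring. Qed.

Lemma Cmod_1_minus_e (x : R) : Cmod (1 - e x) = 2 * Rabs (sin (PI * x)).
Proof.
  assert (H : Cmod (1 - e x) ^ 2 = (2 * Rabs (sin (PI * x))) ^ 2).
  { rewrite Cmod2_alt. unfold e; simpl Re; simpl Im.
    replace (2 * PI * x) with (2 * (PI * x)) by ring.
    rewrite cos_2a_sin, sin_2a, Rpow_mult_distr, pow2_abs.
    pose proof (sin2_cos2 (PI * x)) as H. unfold Rsqr in H.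
    set (s := sin (PI * x)) in *. set (k := cos (PI * x)) in *. nra. }
  assert (H1 := Cmod_ge_0 (1 - e x)). assert (H2 := Rabs_pos (sin (PI * x))).
  nra.
Qed.

Lemma Cmod_e_sub (x y : R) : Cmod (e x - e y) <= 2 * PI * Rabs (x - y).
Proof.
  replace (e x - e y)%C with (- e y * (1 - e (x - y)))%C.
  - rewrite Cmod_mult, Cmod_opp, Cmod_e, Cmod_1_minus_e.
    assert (H : Rabs (sin (PI * (x - y))) <= PI * Rabs (x - y)); [|lra].
    replace (PI * Rabs (x - y)) with (Rabs (PI * (x - y))).
    2:{ rewrite Rabs_mult, (Rabs_pos_eq PI); [reflexivity|]. pose proof PI_RGT_0; lra. }
    generalize (PI * (x - y)). intros t.
    destruct (Rtotal_order t 0) as [Ht|[Ht|Ht]].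
    + rewrite (Rabs_left t) by lra. rewrite <- (Rabs_Ropp (sin t)), <- sin_neg.
      assert (H1 := sin_lt_x (- t)). assert (H2 := sin_lt_x (- - t)).
      apply Rabs_le. split; [|lra].
      destruct (Rle_dec (- t) PI).
      * assert (0 <= sin (- t)) by (apply sin_ge_0; lra). lra.
      * assert (H3 := SIN_bound (- t)). pose proof PI2_1. lra.
    + subst. rewrite sin_0, Rabs_R0. lra.
    + rewrite (Rabs_pos_eq t) by lra. apply Rabs_le.
      assert (H1 := sin_lt_x t). split; [|lra].
      destruct (Rle_dec t PI).
      * assert (0 <= sin t) by (apply sin_ge_0; lra). lra.
      * assert (H3 := SIN_bound t). pose proof PI2_1. lra.
  - unfold Rminus. rewrite e_add.
    replace (- e y * (1 - e x * e (- y)))%C with (e x * (e y * e (- y)) - e y)%C by ring.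
    rewrite <- (e_add y), Rplus_opp_r, e_0. ring.
Qed.

Lemma geom_sum_e (y : R) (n : nat) :
  (sumC (fun i => e (INR i * y)) n * (1 - e y) = 1 - e (INR n * y))%C.
Proof.
  induction n as [|n IH].
  - simpl sumC. simpl INR. rewrite Rmult_0_l, e_0. ring.
  - simpl sumC. rewrite Cmult_plus_distr_r, IH, S_INR, Rmult_plus_distr_r, Rmult_1_l, e_add. ring.
Qed.

(** The product form of the bound [1 / |sin (PI y)|] stays meaningful when [y] is an integer. *)
Lemma geom_sum_e_bound (y : R) (n : nat) :
  Cmod (sumC (fun i => e (INR i * y)) n) * Rabs (sin (PI * y)) <= 1.
Proof.
  assert (H := geom_sum_e y n). apply (f_equal Cmod) in H.
  rewrite Cmod_mult, !Cmod_1_minus_e in H.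
  assert (Rabs (sin (PI * (INR n * y))) <= 1); [|lra].
  apply Rabs_le. apply SIN_bound.
Qed.

Lemma sumC_e_le (x : nat -> R) (n : nat) : Cmod (sumC (fun i => e (x i)) n) <= INR n.
Proof.
  eapply Rle_trans; [apply sumC_Cmod|]. rewrite <- (Rmult_1_r (INR n)).
  apply sumR_bound. intros. rewrite Cmod_e. lra.
Qed.

(** For [x = PI s <= 2] the Taylor bound [x - x^3 / 6] is at least [x / 3], and [PI > 3]. *)
Lemma sin_PI_ge (s : R) : 0 <= s <= / 2 -> s <= sin (PI * s).
Proof.
  intros Hs. assert (H3 : 3 < PI) by (pose proof PI2_3_2; unfold PI2 in *; lra).
  pose proof PI_4.
  assert (Hx : 0 <= PI * s <= 2) by nra.
  destruct (pre_sin_bound (PI * s) 0) as [H1 _]; [lra|lra|].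
  eapply Rle_trans; [|exact H1]. unfold sin_approx, sin_term; simpl.
  set (x := PI * s) in *. 
  replace (_ + _) with (x * (1 - x * x / 6)) by field.
  assert (x * x <= 4) by nra. assert (3 * s <= x) by (unfold x; nra). nra.
Qed.

(** * The Fourier transform of the Thue-Morse sequence *)

Definition psi (m : nat) : R := (-1) ^ s2 m.

Lemma s2_double (n : nat) : s2 (2 * n) = s2 n.
Proof.
  unfold s2. replace (N.of_nat (2 * n)) with (2 * N.of_nat n)%N by lia.
  destruct (N.of_nat n); reflexivity.
Qed.

Lemma s2_double_succ (n : nat) : s2 (2 * n + 1) = S (s2 n).
Proof.
  unfold s2. replace (N.of_nat (2 * n + 1)) with (2 * N.of_nat n + 1)%N by lia.
  destruct (N.of_nat n); reflexivity.
Qed.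

Lemma psi_double (n : nat) : psi (2 * n) = psi n.
Proof. unfold psi. now rewrite s2_double. Qed.

Lemma psi_double_succ (n : nat) : psi (2 * n + 1) = - psi n.
Proof. unfold psi. rewrite s2_double_succ; simpl; ring. Qed.

(** Adding [n < 2^la] to a multiple of [2^la] causes no carry, so the digit sums add up. *)
Lemma psi_add_pow2 (la m n : nat) :
  (n < 2 ^ la)%nat -> psi (m * 2 ^ la + n) = psi m * psi n.
Proof.
  revert m n. induction la as [|la IH]; intros m n Hn; simpl in Hn.
  - replace n with 0%nat by lia. simpl. rewrite Nat.mul_1_r, Nat.add_0_r.
    unfold psi at 3; simpl. ring.
  - assert (Hd := Nat.div_mod_eq n 2).
    assert (Hlt : (n / 2 < 2 ^ la)%nat) by (apply Nat.Div0.div_lt_upper_bound; lia).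
    assert (Hr : (n mod 2 = 0 \/ n mod 2 = 1)%nat)
      by (assert (H := Nat.mod_upper_bound n 2); lia).
    assert (IHn := IH m (n / 2)%nat Hlt).
    destruct Hr as [Hr|Hr]; rewrite Hr in Hd.
    + replace (m * 2 ^ S la + n)%nat with (2 * (m * 2 ^ la + n / 2))%nat by (rewrite Nat.pow_succ_r'; lia).
      rewrite psi_double, IHn. replace n with (2 * (n / 2))%nat at 2 by lia.
      now rewrite psi_double.
    + replace (m * 2 ^ S la + n)%nat with (2 * (m * 2 ^ la + n / 2) + 1)%nat by (rewrite Nat.pow_succ_r'; lia).
      rewrite psi_double_succ, IHn. replace n with (2 * (n / 2) + 1)%nat at 2 by lia.
      rewrite psi_double_succ; ring.
Qed.

Lemma Rabs_psi (m : nat) : Rabs (psi m) = 1.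
Proof. apply pow_1_abs. Qed.

Fixpoint tmP (la : nat) (x : R) : R :=
  match la with
  | O => 1
  | S l => Rabs (sin (PI * x)) * tmP l (2 * x)
  end.

Lemma INR_pow2 (n : nat) : INR (2 ^ n) = 2 ^ n.
Proof. rewrite pow_INR. reflexivity. Qed.

Lemma pow2_gt0 (n : nat) : 0 < 2 ^ n.
Proof. apply pow_lt; lra. Qed.

(** Grouping [2m] with [2m + 1] pulls out the factor [1 - e (-x)], of modulus [2 |sin (PI x)|], and
    leaves the same sum at [2x]. *)
Lemma Cmod_tm_fourier (la : nat) (x : R) :
  Cmod (sumC (fun m => RtoC (psi m) * e (- (INR m * x)))%C (2 ^ la)) = 2 ^ la * tmP la x.
Proof.
  revert x. induction la as [|la IH]; intros x.
  - simpl. unfold psi; simpl. rewrite Rmult_0_l, Ropp_0, e_0, Rmult_1_r, Cmult_1_r, Cplus_0_l.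
    apply Cmod_1.
  - replace (2 ^ S la)%nat with (2 ^ la * 2)%nat by (simpl; lia).
    rewrite sumC_block.
    rewrite (sumC_ext _ (fun m => (1 - e (- x)) * (RtoC (psi m) * e (- (INR m * (2 * x)))))%C).
    + rewrite sumC_scal, Cmod_mult, IH, Cmod_1_minus_e. simpl.
      replace (PI * - x) with (- (PI * x)) by ring. rewrite sin_neg, Rabs_Ropp. ring.
    + intros m _. simpl sumC. rewrite Nat.add_0_r, (Nat.mul_comm m 2).
      rewrite psi_double, psi_double_succ.
      rewrite plus_INR, mult_INR. simpl INR.
      replace (- ((1 + 1) * INR m * x)) with (- (INR m * (2 * x))) by ring.
      replace (- (((1 + 1) * INR m + 1) * x)) with (- (INR m * (2 * x)) + - x) by ring.
      rewrite e_add, RtoC_opp. ring.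
Qed.

Lemma tmP_ge0 (la : nat) (x : R) : 0 <= tmP la x.
Proof.
  revert x. induction la as [|la IH]; intros x; simpl; [lra|].
  apply Rmult_le_pos; [apply Rabs_pos|apply IH].
Qed.

Lemma Rabs_sin_add_PI (x : R) (k : nat) : Rabs (sin (x + INR k * PI)) = Rabs (sin x).
Proof.
  induction k as [|k IH]; [simpl; f_equal; f_equal; ring|].
  rewrite S_INR. replace (x + (INR k + 1) * PI) with (x + INR k * PI + PI) by ring.
  rewrite neg_sin, Rabs_Ropp. exact IH.
Qed.

Lemma tmP_add_INR (la : nat) (x : R) (k : nat) : tmP la (x + INR k) = tmP la x.
Proof.
  revert x k. induction la as [|la IH]; intros x k; simpl; [reflexivity|].
  replace (PI * (x + INR k)) with (PI * x + INR k * PI) by ring.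
  rewrite Rabs_sin_add_PI. f_equal.
  rewrite <- (IH (2 * x) (2 * k)%nat). f_equal. rewrite mult_INR. simpl INR. ring.
Qed.

Lemma tmP_opp (la : nat) (x : R) : tmP la (- x) = tmP la x.
Proof.
  revert x. induction la as [|la IH]; intros x; simpl; [reflexivity|].
  replace (PI * - x) with (- (PI * x)) by ring.
  replace (2 * - x) with (- (2 * x)) by ring. rewrite sin_neg, Rabs_Ropp, IH. reflexivity.
Qed.

(** [tmP] unfolds at its lowest factor; the recursion for the L1 norm has to split off the highest
    one. *)
Lemma tmP_succ_top (la : nat) (x : R) :
  tmP (S la) x = tmP la x * Rabs (sin (PI * (2 ^ la * x))).
Proof.
  revert x. induction la as [|la IH]; intros x.
  - simpl. rewrite !Rmult_1_l, Rmult_1_r. reflexivity.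
  - change (Rabs (sin (PI * x)) * tmP (S la) (2 * x) =
      Rabs (sin (PI * x)) * tmP la (2 * x) * Rabs (sin (PI * (2 ^ S la * x)))).
    rewrite IH. replace (2 ^ la * (2 * x)) with (2 ^ S la * x) by (simpl; ring). ring.
Qed.

Lemma Rabs_sin_le (x : R) : Rabs (sin x) <= 1.
Proof. apply Rabs_le, SIN_bound. Qed.

Lemma tmP_le1 (la : nat) (x : R) : tmP la x <= 1.
Proof.
  revert x. induction la as [|la IH]; intros x; simpl; [lra|].
  assert (H1 := Rabs_sin_le (PI * x)). assert (H2 := Rabs_pos (sin (PI * x))).
  assert (H3 := IH (2 * x)). assert (H4 := tmP_ge0 la (2 * x)). nra.
Qed.

(* Only the first [j] factors of the product are used. *)
Lemma tmP_small (j la : nat) (x : R) :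
  (j <= la)%nat -> 0 <= x -> tmP la x <= (4 * 2 ^ j * x) ^ j.
Proof.
  revert la x. induction j as [|j IH]; intros la x Hj Hx.
  - rewrite pow_O. apply tmP_le1.
  - destruct la as [|la]; [lia|].
    change (Rabs (sin (PI * x)) * tmP la (2 * x) <= (4 * 2 ^ S j * x) ^ S j).
    assert (H1 : Rabs (sin (PI * x)) <= 4 * 2 ^ S j * x).
    { assert (H := Cmod_e_sub 0 x). rewrite e_0, Cmod_1_minus_e in H.
      rewrite Rminus_0_l, Rabs_Ropp, (Rabs_pos_eq x) in H by lra.
      assert (1 <= 2 ^ S j) by (apply pow_R1_Rle; lra). pose proof PI_4. nra. }
    assert (H2 := IH la (2 * x) ltac:(lia) ltac:(lra)).
    replace (4 * 2 ^ j * (2 * x)) with (4 * 2 ^ S j * x) in H2 by (simpl; ring).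
    change ((4 * 2 ^ S j * x) ^ S j) with ((4 * 2 ^ S j * x) * (4 * 2 ^ S j * x) ^ j).
    apply Rmult_le_compat; [apply Rabs_pos|apply tmP_ge0|exact H1|exact H2].
Qed.

(** * The L1 norm of the products, by a transfer operator *)

Definition tm_rho : R := 1325 / 1000.

Lemma tm_weight_poly (p : R) : 1 <= p -> p * p <= 2 ->
  p + 34 / 100 * 1 - 3 / 100 * (p * (1 - (p * p - 1) / 2))
  <= 1325 / 1000 * (1 + 34 / 100 * (p * p - 1) - 3 / 100 * (p * p - 1) ^ 2).
Proof.
  intros H1 H2.
  assert (Hp : p <= 14143 / 10000) by nra.
  set (w := p - 1). assert (Hw : 0 <= w <= 4143 / 10000) by (unfold w; lra).
  (* With [w <= sqrt 2 - 1], rounded up, the cubic and quartic terms of the difference are absorbed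
     into the quadratic one, whose coefficient stays above 0.1675. The remaining quadratic has
     negative discriminant; [H5] checks it by a square centred near its minimum. *)
  assert (H3 : w ^ 3 <= 4143 / 10000 * w ^ 2) by nra.
  assert (H4 : w ^ 4 <= 1717 / 10000 * w ^ 2).
  { assert (w * w <= 1717 / 10000) by nra. nra. }
  assert (H5 : 0 <= 15 / 1000 - 99 / 1000 * w + 1675 / 10000 * w ^ 2)
    by (pose proof (pow2_ge_0 (w - 2954 / 10000)); lra).
  replace p with (1 + w) by (unfold w; ring). clearbody w. clear - H3 H4 H5.
  match goal with |- ?a <= ?b => replace b with
    (a + (15 / 1000 - 99 / 1000 * w + 2465 / 10000 * w ^ 2 - 174 / 1000 * w ^ 3
          - 3975 / 100000 * w ^ 4)) by field end.
  pose proof (pow2_ge_0 w). lra.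
Qed.

(** At least 1 on [[0, 1]], which starts the induction on [la], and equal to 1 at 0, so that the
    final L1 bound is [tm_rho ^ la] with constant 1. *)
Definition tm_weight (th : R) : R :=
  1 + 34 / 100 * sin (PI * th) - 3 / 100 * sin (PI * th) ^ 2.

(* An approximate positive eigenfunction of the transfer operator of the
   products [tmP]; in the variable [sin + cos] the claim is polynomial. *)
Lemma tm_weight_transfer (th : R) : 0 <= th <= 1 ->
  Rabs (sin (PI * (th / 2))) * tm_weight (th / 2)
  + Rabs (sin (PI * ((1 + th) / 2))) * tm_weight ((1 + th) / 2)
  <= tm_rho * tm_weight th.
Proof.
  intros Hth. unfold tm_weight, tm_rho.
  replace (PI * ((1 + th) / 2)) with (PI / 2 + PI * (th / 2)) by field.
  rewrite <- cos_sin.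
  replace (PI * th) with (2 * (PI * (th / 2))) by field.
  rewrite sin_2a. set (x := PI * (th / 2)).
  assert (Hx : 0 <= x <= PI / 2) by (unfold x; pose proof PI_RGT_0; nra).
  assert (Hs : 0 <= sin x) by (apply sin_ge_0; lra).
  assert (Hk : 0 <= cos x) by (apply cos_ge_0; lra).
  rewrite !Rabs_pos_eq by assumption.
  assert (Hsk := sin2_cos2 x). unfold Rsqr in Hsk.
  set (s := sin x) in *. set (k := cos x) in *. clearbody s k. clear x Hx Hth.
  set (p := s + k).
  assert (Hsk2 : s * k = (p * p - 1) / 2) by (unfold p; nra).
  assert (Hp : 1 <= p) by (unfold p; nra).
  assert (Hp2 : p * p <= 2) by (pose proof (pow2_ge_0 (s - k)); unfold p; lra).
  replace (2 * s * k) with (p * p - 1) by lra.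
  replace (s * (1 + 34 / 100 * s - 3 / 100 * s ^ 2) + k * (1 + 34 / 100 * k - 3 / 100 * k ^ 2))
    with (p + 34 / 100 * (s * s + k * k) - 3 / 100 * (p * (s * s + k * k - s * k)))
    by (unfold p; ring).
  rewrite Hsk2, Hsk. now apply tm_weight_poly.
Qed.

(** Only [th = 0] is wanted in the end; the shift is there because the recursion sends [th] to
    [th / 2] and [(1 + th) / 2]. *)
Definition tmL1 (la : nat) (th : R) : R :=
  sumR (fun h => tmP la ((INR h + th) / 2 ^ la)) (2 ^ la).

(** For [h = 2j + r] the highest factor of the product depends on [j] only through a multiple of
    [PI], hence on [r] alone, and the other factors form the product of level [la] at shift
    [(r + th) / 2]. *)
Lemma tmL1_succ (la : nat) (th : R) :
  tmL1 (S la) th =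
  Rabs (sin (PI * (th / 2))) * tmL1 la (th / 2)
  + Rabs (sin (PI * ((1 + th) / 2))) * tmL1 la ((1 + th) / 2).
Proof.
  unfold tmL1. replace (2 ^ S la)%nat with (2 ^ la * 2)%nat by (simpl; lia).
  rewrite sumR_block, <- !sumR_scal, <- sumR_plus. apply sumR_ext. intros j _.
  assert (H : forall r, tmP (S la) ((INR (j * 2 + r) + th) / 2 ^ S la) =
    Rabs (sin (PI * ((INR r + th) / 2))) * tmP la ((INR j + (INR r + th) / 2) / 2 ^ la)).
  { intros r. assert (H2 := pow2_gt0 la).
    replace ((INR (j * 2 + r) + th) / 2 ^ S la) with ((INR j + (INR r + th) / 2) / 2 ^ la).
    2:{ rewrite plus_INR, mult_INR. simpl. field. lra. }
    rewrite tmP_succ_top.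
    replace (PI * (2 ^ la * ((INR j + (INR r + th) / 2) / 2 ^ la)))
      with (PI * ((INR r + th) / 2) + INR j * PI) by (field; lra).
    rewrite Rabs_sin_add_PI. ring. }
  cbn [sumR]. rewrite !H. simpl INR. rewrite !Rplus_0_l. reflexivity.
Qed.

Lemma tmL1_le (la : nat) (th : R) :
  0 <= th <= 1 -> tmL1 la th <= tm_rho ^ la * tm_weight th.
Proof.
  revert th. induction la as [|la IH]; intros th Hth.
  - unfold tmL1, tm_weight; simpl.
    assert (0 <= sin (PI * th)) by (apply sin_ge_0; pose proof PI_RGT_0; nra).
    assert (sin (PI * th) <= 1) by apply SIN_bound. nra.
  - rewrite tmL1_succ. simpl. rewrite (Rmult_comm tm_rho), Rmult_assoc.
    assert (Hr : 0 <= tm_rho ^ la) by (apply pow_le; unfold tm_rho; lra).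
    assert (H1 := IH (th / 2) ltac:(lra)).
    assert (H2 := IH ((1 + th) / 2) ltac:(lra)).
    assert (H3 := Rabs_pos (sin (PI * (th / 2)))).
    assert (H4 := Rabs_pos (sin (PI * ((1 + th) / 2)))).
    assert (H5 := tm_weight_transfer th Hth).
    apply Rle_trans with (tm_rho ^ la *
      (Rabs (sin (PI * (th / 2))) * tm_weight (th / 2)
       + Rabs (sin (PI * ((1 + th) / 2))) * tm_weight ((1 + th) / 2))).
    + rewrite Rmult_plus_distr_l.
      apply Rplus_le_compat.
      * apply Rle_trans with (Rabs (sin (PI * (th / 2))) * (tm_rho ^ la * tm_weight (th / 2)));
          [now apply Rmult_le_compat_l|right; ring].
      * apply Rle_trans with (Rabs (sin (PI * ((1 + th) / 2)))
          * (tm_rho ^ la * tm_weight ((1 + th) / 2)));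
          [now apply Rmult_le_compat_l|right; ring].
    + now apply Rmult_le_compat_l.
Qed.

Lemma tm_fourier_L1 (la : nat) :
  sumR (fun h => tmP la (INR h / 2 ^ la)) (2 ^ la) <= tm_rho ^ la.
Proof.
  assert (H := tmL1_le la 0 ltac:(lra)).
  replace (tm_rho ^ la) with (tm_rho ^ la * tm_weight 0).
  - eapply Rle_trans; [|exact H]. right. apply sumR_ext. intros h _.
    now rewrite Rplus_0_r.
  - unfold tm_weight. rewrite Rmult_0_r, sin_0. ring.
Qed.

(** * Interpolation by the Fejer kernel *)

Lemma sumR_shift (f : nat -> R) (n : nat) :
  sumR f (S n) = f 0%nat + sumR (fun i => f (S i)) n.
Proof. change (S n) with (1 + n)%nat. rewrite sumR_app. simpl. ring. Qed.

Lemma sumR_rev (f : nat -> R) (n : nat) :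
  sumR (fun i => f (n - 1 - i)%nat) n = sumR f n.
Proof.
  induction n as [|n IH]; [reflexivity|].
  rewrite sumR_shift. simpl sumR. rewrite <- IH, Rplus_comm. f_equal.
  - apply sumR_ext. intros i Hi. f_equal. lia.
  - f_equal. lia.
Qed.

Lemma sumR_periodic (f : nat -> R) (n s : nat) :
  (forall i, f (i + n)%nat = f i) -> sumR (fun i => f (i + s)%nat) n = sumR f n.
Proof.
  intros Hf. induction s as [|s IH].
  - apply sumR_ext. intros; f_equal; lia.
  - rewrite <- IH.
    assert (H1 := sumR_shift (fun i => f (i + s)%nat) n). simpl in H1.
    assert (H2 : f (n + s)%nat = f s) by (rewrite Nat.add_comm; apply Hf).
    rewrite (sumR_ext _ (fun i => f (S (i + s)))) by (intros; f_equal; lia). lra.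
Qed.

(** A difference [t > 0] is attained up to sign by [2 (n - t)] pairs; [t = 0] is counted twice on
    the right, whence the inequality. *)
Lemma sumR_diff_le (phi : R -> R) (n : nat) :
  (forall x, phi (- x) = phi x) -> (forall x, 0 <= phi x) ->
  sumR (fun j => sumR (fun k => phi (INR j - INR k)) n) n
  <= 2 * sumR (fun t => (INR n - INR t) * phi (INR t)) n.
Proof.
  intros He Hp. induction n as [|n IH]; [simpl; lra|].
  cbn [sumR]. rewrite sumR_plus.
  rewrite (sumR_ext (fun i => phi (INR i - INR n)) (fun i => phi (INR n - INR i)))
    by (intros; rewrite <- He; f_equal; ring).
  replace (sumR (fun t => (INR (S n) - INR t) * phi (INR t)) n) with
    (sumR (fun t => (INR n - INR t) * phi (INR t)) n + sumR (fun t => phi (INR t)) n)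
    by (rewrite <- sumR_plus; apply sumR_ext; intros; rewrite S_INR; ring).
  assert (H : sumR (fun i => phi (INR n - INR i)) n + phi 0
              = sumR (fun t => phi (INR t)) n + phi (INR n)).
  { assert (H1 := sumR_shift (fun t => phi (INR t)) n). cbn [sumR] in H1. rewrite H1.
    rewrite Rplus_comm. f_equal. rewrite <- (sumR_rev (fun i => phi (INR (S i)))).
    apply sumR_ext. intros i Hi. f_equal.
    rewrite <- minus_INR by lia. f_equal. lia. }
  replace (INR n - INR n) with 0 by ring. rewrite S_INR.
  assert (H0 := Hp 0). lra.
Qed.

Lemma Cmod2_sum_e (x : nat -> R) (n : nat) :
  RtoC (Cmod (sumC (fun j => e (x j)) n) ^ 2)
  = sumC (fun j => sumC (fun k => e (x j - x k)) n) n.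
Proof.
  rewrite Cmod2_conj, sumC_conj.
  rewrite Cmult_comm, <- sumC_scal. apply sumC_ext. intros j _.
  rewrite Cmult_comm, <- sumC_scal. apply sumC_ext. intros k _.
  unfold Rminus. rewrite e_add, e_opp. reflexivity.
Qed.

(** The kernel [sin (PI y)^2 / (n sin (PI y / n))^2], with [y] measured in grid steps and period
    [n]. The squared modulus avoids its removable singularities. *)
Definition fejer (n : nat) (y : R) : R :=
  Cmod (sumC (fun j => e (INR j * (y / INR n))) n) ^ 2 / INR n ^ 2.

Definition dft (g : nat -> R) (n : nat) (t : R) : C :=
  (/ RtoC (INR n) * sumC (fun u => RtoC (g u) * e (- (t * INR u / INR n))) n)%C.

(** Opening the square gives pairs [(j, k)], and summing over [u] first yields the discrete Fourier
    coefficient at [j - k]. The Fejer weights [1 - |t| / n] are present as the number of pairs with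
    [j - k = t], divided by [n]. *)
Lemma fejer_interpolation (g : nat -> R) (n : nat) (y : R) : (0 < n)%nat ->
  RtoC (sumR (fun u => g u * fejer n (y - INR u)) n)
  = (/ RtoC (INR n) * sumC (fun j => sumC (fun k =>
       dft g n (INR j - INR k) * e ((INR j - INR k) * y / INR n)) n) n)%C.
Proof.
  intros Hn. assert (Hn' : INR n <> 0) by (apply not_0_INR; lia).
  assert (HnC : RtoC (INR n) <> RtoC 0) by (intros H; apply RtoC_inj in H; contradiction).
  rewrite <- sumC_RtoC.
  rewrite (sumC_ext _ (fun u => sumC (fun j => sumC (fun k =>
    / RtoC (INR n) * (/ RtoC (INR n) * (RtoC (g u) * e (- ((INR j - INR k) * INR u / INR n)))
      * e ((INR j - INR k) * y / INR n)))%C n) n)).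
  - rewrite sumC_swap, <- sumC_scal. apply sumC_ext. intros j _.
    rewrite sumC_swap, <- sumC_scal. apply sumC_ext. intros k _.
    rewrite sumC_scal. f_equal. unfold dft.
    rewrite <- Cmult_assoc, (Cmult_comm (sumC _ _)), Cmult_assoc, <- sumC_scal.
    apply sumC_ext. intros u _. ring.
  - intros u _. unfold fejer.
    unfold Rdiv at 1. rewrite 2!RtoC_mult, Cmod2_sum_e, RtoC_inv, RtoC_pow.
    rewrite (Cmult_comm (sumC _ _)), Cmult_assoc, <- sumC_scal.
    apply sumC_ext. intros j _. rewrite <- sumC_scal.
    apply sumC_ext. intros k _.
    replace (INR j * ((y - INR u) / INR n) - INR k * ((y - INR u) / INR n))
      with (- ((INR j - INR k) * INR u / INR n) + (INR j - INR k) * y / INR n) by (field; exact Hn').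
    rewrite e_add. field. exact HnC.
    now apply pow_nonzero.
Qed.

Lemma dft_one (n j k : nat) : (j < n)%nat -> (k < n)%nat ->
  dft (fun _ => 1) n (INR j - INR k) = if Nat.eqb j k then RtoC 1 else RtoC 0.
Proof.
  intros Hj Hk. assert (Hn : 0 < INR n) by (apply lt_0_INR; lia).
  assert (HnC : RtoC (INR n) <> RtoC 0) by (intros H; apply RtoC_inj in H; lra).
  unfold dft. set (y := (INR k - INR j) / INR n).
  rewrite (sumC_ext _ (fun u => e (INR u * y))).
  2:{ intros u _. rewrite Cmult_1_l. f_equal. unfold y. field. lra. }
  destruct (Nat.eqb_spec j k) as [E|E].
  - rewrite (sumC_ext _ (fun _ => RtoC 1)).
    + rewrite sumC_RtoC, sumR_const, Rmult_1_r. field. exact HnC.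
    + intros u _. unfold y. rewrite E. replace (INR u * _) with 0 by (field; lra). apply e_0.
  - assert (H := geom_sum_e y n).
    replace (e (INR n * y)) with (RtoC 1) in H.
    2:{ unfold y. replace (INR n * _) with (INR k - INR j) by (field; lra).
        now rewrite e_sub_INR, e_INR. }
    assert (Hy : (1 - e y)%C <> RtoC 0).
    { intros H0. apply (f_equal Cmod) in H0. rewrite Cmod_0, Cmod_1_minus_e in H0.
      assert (Hs : 0 < Rabs (sin (PI * y))); [|lra].
      apply Rabs_pos_lt.
      assert (Hjk : INR j < INR n /\ INR k < INR n) by (split; now apply lt_INR).
      assert (Hp : 0 <= INR j /\ 0 <= INR k) by (split; apply pos_INR).
      assert (Hny : INR n * y = INR k - INR j) by (unfold y; field; lra).
      pose proof PI_RGT_0 as HPI.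
      assert (H1 : (j < k \/ k < j)%nat) by lia.
      destruct H1 as [H1|H1]; apply lt_INR in H1.
      - assert (0 < y < 1) by nra.
        assert (0 < sin (PI * y)) by (apply sin_gt_0; nra). lra.
      - assert (-1 < y < 0) by nra.
        assert (0 < sin (- (PI * y))) by (apply sin_gt_0; nra). rewrite sin_neg in *. lra. }
    replace (sumC _ n) with (RtoC 0); [ring|].
    apply (f_equal (fun z => z * / (1 - e y))%C) in H.
    rewrite <- Cmult_assoc, Cinv_r, Cmult_1_r in H by exact Hy. rewrite H. ring.
Qed.

Lemma sumC_delta (n j : nat) (a : C) : (j < n)%nat ->
  sumC (fun k => if Nat.eqb j k then a else RtoC 0) n = a.
Proof.
  induction n as [|n IH]; intros Hj; [lia|]. simpl.
  destruct (Nat.eqb_spec j n) as [E|E].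
  - rewrite (sumC_ext _ (fun _ => RtoC 0)).
    + rewrite sumC_zero; ring.
    + intros i Hi. destruct (Nat.eqb_spec j i); [lia|reflexivity].
  - rewrite IH by lia. ring.
Qed.

(** Interpolation of the constant 1: by orthogonality only the [n] diagonal pairs survive. *)
Lemma fejer_partition (n : nat) (y : R) : (0 < n)%nat ->
  sumR (fun u => fejer n (y - INR u)) n = 1.
Proof.
  intros Hn. apply RtoC_inj.
  rewrite (sumR_ext _ (fun u => 1 * fejer n (y - INR u))) by (intros; ring).
  rewrite fejer_interpolation by exact Hn.
  rewrite (sumC_ext _ (fun _ => RtoC 1)).
  - rewrite sumC_RtoC, sumR_const, Rmult_1_r. field.
    intros H; apply RtoC_inj in H. apply (not_0_INR n); [lia|exact H].
  - intros j Hj. rewrite <- (sumC_delta n j (RtoC 1)) by exact Hj.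
    apply sumC_ext. intros k Hk. rewrite dft_one by assumption.
    destruct (Nat.eqb_spec j k) as [E|E]; [|ring].
    rewrite E. replace ((INR k - INR k) * y / INR n) with 0 by (unfold Rdiv; ring).
    rewrite e_0. ring.
Qed.

Lemma fejer_ge0 (n : nat) (y : R) : 0 <= fejer n y.
Proof.
  unfold fejer, Rdiv. rewrite <- pow_inv. apply Rmult_le_pos; apply pow2_ge_0.
Qed.

Lemma sin_PI_ge_min (s : R) : 0 <= s <= 1 -> Rmin s (1 - s) <= sin (PI * s).
Proof.
  intros Hs. destruct (Rle_dec s (/ 2)) as [H|H].
  - rewrite Rmin_left by lra. apply sin_PI_ge; lra.
  - rewrite Rmin_right by lra. replace (PI * s) with (PI - PI * (1 - s)) by ring.
    rewrite sin_PI_x. apply sin_PI_ge; lra.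
Qed.

(** The kernel is at most the inverse square of the cyclic distance [min (z, n - z)]; a sum of two
    terms is easier to add over [z] than a minimum. *)
Lemma fejer_opp_le (n : nat) (z : R) : 0 < z < INR n ->
  fejer n (- z) <= / z ^ 2 + / (INR n - z) ^ 2.
Proof.
  intros Hz. unfold fejer.
  assert (Hb := geom_sum_e_bound (- z / INR n) n).
  set (w := Cmod _) in *. assert (Hw : 0 <= w) by apply Cmod_ge_0.
  assert (Hs : 0 <= z / INR n <= 1).
  { split; [apply Rlt_le, Rdiv_lt_0_compat; lra|].
    apply Rmult_le_reg_r with (INR n); [lra|]. unfold Rdiv.
    rewrite Rmult_assoc, Rinv_l; lra. }
  assert (Hm := sin_PI_ge_min _ Hs).
  replace (PI * (- z / INR n)) with (- (PI * (z / INR n))) in Hb by (field; lra).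
  rewrite sin_neg, Rabs_Ropp in Hb.
  assert (H0 := Rle_abs (sin (PI * (z / INR n)))).
  assert (Hkey : forall t, 0 < t -> w * (t / INR n) <= 1 -> w ^ 2 / INR n ^ 2 <= / t ^ 2).
  { intros t Ht H. replace (w ^ 2 / INR n ^ 2) with ((w * (t / INR n)) ^ 2 * / t ^ 2)
      by (field; lra).
    rewrite <- (Rmult_1_l (/ t ^ 2)) at 2. apply Rmult_le_compat_r.
    - apply Rlt_le, Rinv_0_lt_compat, pow_lt; lra.
    - assert (0 <= w * (t / INR n)).
      { apply Rmult_le_pos; [exact Hw|]. apply Rlt_le, Rdiv_lt_0_compat; lra. }
      simpl; nra. }
  assert (0 < / z ^ 2) by (apply Rinv_0_lt_compat, pow_lt; lra).
  assert (0 < / (INR n - z) ^ 2) by (apply Rinv_0_lt_compat, pow_lt; lra).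
  unfold Rmin in Hm. destruct (Rle_dec (z / INR n) (1 - z / INR n)).
  - assert (w ^ 2 / INR n ^ 2 <= / z ^ 2); [|lra]. apply Hkey; [lra|]. nra.
  - assert (w ^ 2 / INR n ^ 2 <= / (INR n - z) ^ 2); [|lra]. apply Hkey; [lra|].
    replace ((INR n - z) / INR n) with (1 - z / INR n) by (field; lra). nra.
Qed.

Lemma sum_inv_sq_succ (d : R) (n : nat) : 0 < d ->
  sumR (fun i => / (d + 1 + INR i) ^ 2) n <= / d.
Proof.
  intros Hd. apply Rle_trans with (/ d - / (d + INR n)).
  - induction n as [|n IH]; [simpl; rewrite Rplus_0_r; lra|].
    cbn [sumR]. rewrite S_INR. assert (Hn := pos_INR n).
    assert (H : / (d + 1 + INR n) ^ 2 <= / (d + INR n) - / (d + (INR n + 1))); [|lra].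
    replace (/ (d + INR n) - / (d + (INR n + 1))) with (/ ((d + INR n) * (d + 1 + INR n)))
      by (field; lra).
    apply Rinv_le_contravar; nra.
  - assert (0 < / (d + INR n)); [|lra].
    apply Rinv_0_lt_compat. pose proof (pos_INR n); lra.
Qed.

Lemma sum_inv_sq (d : R) (n : nat) : 0 < d ->
  sumR (fun i => / (d + INR i) ^ 2) n <= / d ^ 2 + / d.
Proof.
  intros Hd. destruct n as [|n].
  - simpl. assert (0 < / d) by now apply Rinv_0_lt_compat.
    assert (0 < / (d * (d * 1))) by (apply Rinv_0_lt_compat; nra). lra.
  - rewrite sumR_shift. apply Rplus_le_compat.
    + simpl INR. rewrite Rplus_0_r. lra.
    + eapply Rle_trans; [|apply (sum_inv_sq_succ d n Hd)]. right. apply sumR_ext.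
      intros i _. rewrite S_INR. do 2 f_equal. ring.
Qed.

(* [psi (floor (u / 2^mu))] as a function of [u] modulo [2^(la + mu)]: the grid of
   step [2^-mu] resolves the jumps of [psi (floor x)]. *)
Definition tmg (la mu u : nat) : R := psi ((u / 2 ^ mu) mod 2 ^ la).

Lemma pow2_nz (n : nat) : (2 ^ n <> 0)%nat.
Proof. apply Nat.pow_nonzero; lia. Qed.

Lemma INR_vol (la mu : nat) : INR (2 ^ la * 2 ^ mu) = 2 ^ la * 2 ^ mu.
Proof. now rewrite mult_INR, !INR_pow2. Qed.

Lemma tmg_add (la mu m i : nat) :
  tmg la mu (i + m * 2 ^ mu) = psi ((m + i / 2 ^ mu) mod 2 ^ la).
Proof.
  unfold tmg. rewrite Nat.div_add by apply pow2_nz. f_equal. f_equal. lia.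
Qed.

Lemma tmg_periodic (la mu u : nat) : tmg la mu (u + 2 ^ la * 2 ^ mu) = tmg la mu u.
Proof.
  unfold tmg. rewrite Nat.div_add by apply pow2_nz.
  rewrite <- (Nat.mul_1_l (2 ^ la)) at 1. now rewrite Nat.Div0.mod_add.
Qed.

(** Writing [u = m 2^mu + w], the value depends on [m] and the character splits, so the coefficient
    is the Thue-Morse transform in [m] times a geometric sum in [w]. *)
Lemma Cmod_dft_tm (la mu : nat) (t : R) :
  Cmod (dft (tmg la mu) (2 ^ la * 2 ^ mu) t) =
  tmP la (t / 2 ^ la)
  * (Cmod (sumC (fun w => e (INR w * (- (t / (2 ^ la * 2 ^ mu))))) (2 ^ mu)) / 2 ^ mu).
Proof.
  assert (H1 := pow2_gt0 la). assert (H2 := pow2_gt0 mu).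
  unfold dft. rewrite INR_vol, sumC_block.
  rewrite (sumC_ext _ (fun m => sumC (fun w => e (INR w * (- (t / (2 ^ la * 2 ^ mu))))) (2 ^ mu)
     * (RtoC (psi m) * e (- (INR m * (t / 2 ^ la)))))%C).
  - rewrite sumC_scal, !Cmod_mult, Cmod_tm_fourier, Cmod_inv, Cmod_R, Rabs_pos_eq.
    + field. lra.
    + nra.
    + intros H. apply RtoC_inj in H. nra.
  - intros m Hm. rewrite Cmult_comm, <- sumC_scal. apply sumC_ext. intros w Hw.
    unfold tmg. rewrite Nat.div_add_l by apply pow2_nz.
    rewrite (Nat.div_small w) by exact Hw. rewrite Nat.add_0_r, Nat.mod_small by exact Hm.
    rewrite <- Cmult_assoc, <- e_add. do 2 f_equal.
    rewrite plus_INR, mult_INR, INR_pow2. field. lra.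
Qed.

Lemma Cmod_dft_tm_le (la mu : nat) (t : R) :
  Cmod (dft (tmg la mu) (2 ^ la * 2 ^ mu) t) <= tmP la (t / 2 ^ la).
Proof.
  rewrite Cmod_dft_tm. assert (H := sumC_e_le (fun w => INR w * (- (t / (2 ^ la * 2 ^ mu)))) (2 ^ mu)).
  rewrite INR_pow2 in H. assert (H2 := pow2_gt0 mu). assert (H3 := tmP_ge0 la (t / 2 ^ la)).
  rewrite <- Rmult_1_r. apply Rmult_le_compat_l; [exact H3|].
  apply Rmult_le_reg_r with (2 ^ mu); [exact H2|]. unfold Rdiv.
  rewrite Rmult_assoc, Rinv_l; lra.
Qed.

Lemma Cmod_dft_tm_opp (la mu : nat) (t : R) :
  Cmod (dft (tmg la mu) (2 ^ la * 2 ^ mu) (- t))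
  = Cmod (dft (tmg la mu) (2 ^ la * 2 ^ mu) t).
Proof.
  rewrite !Cmod_dft_tm.
  replace (- t / 2 ^ la) with (- (t / 2 ^ la)) by (unfold Rdiv; ring).
  rewrite tmP_opp. do 2 f_equal. rewrite <- Cmod_conj, sumC_conj. f_equal.
  apply sumC_ext. intros w _. rewrite <- e_opp. f_equal. unfold Rdiv; ring.
Qed.

(** With [s] the quotient of [t] by the number of grid points, the geometric sum is at most
    [1 / |sin (PI s)|], which blows up at [s = 1] as well as at [s = 0]. The Fejer weight [1 - s]
    cancels the former because [sin (PI s) >= s (1 - s)]. *)
Lemma Cmod_dft_tm_decay (la mu : nat) (t : R) : 0 < t < 2 ^ la * 2 ^ mu ->
  (1 - t / (2 ^ la * 2 ^ mu)) * Cmod (dft (tmg la mu) (2 ^ la * 2 ^ mu) t)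
  <= tmP la (t / 2 ^ la) * (2 ^ la / t).
Proof.
  intros Ht. assert (H1 := pow2_gt0 la). assert (H2 := pow2_gt0 mu).
  rewrite Cmod_dft_tm. set (V := 2 ^ la * 2 ^ mu) in *.
  assert (Hs : 0 <= t / V <= 1).
  { split; [apply Rlt_le, Rdiv_lt_0_compat; lra|].
    apply Rmult_le_reg_r with V; [lra|]. unfold Rdiv. rewrite Rmult_assoc, Rinv_l; lra. }
  assert (Hm := sin_PI_ge_min _ Hs).
  assert (Hb := geom_sum_e_bound (- (t / V)) (2 ^ mu)).
  replace (PI * (- (t / V))) with (- (PI * (t / V))) in Hb by ring.
  rewrite sin_neg, Rabs_Ropp in Hb.
  assert (H0 := Rle_abs (sin (PI * (t / V)))).
  set (w := Cmod _) in *. assert (Hw : 0 <= w) by apply Cmod_ge_0.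
  set (s := t / V) in *.
  assert (Hmul : (1 - s) * w * s <= 1).
  { assert (Hss : s * (1 - s) <= Rmin s (1 - s)).
    { unfold Rmin. destruct (Rle_dec s (1 - s)); nra. }
    nra. }
  replace ((1 - s) * (tmP la (t / 2 ^ la) * (w / 2 ^ mu)))
    with (tmP la (t / 2 ^ la) * ((1 - s) * w / 2 ^ mu)) by (field; lra).
  apply Rmult_le_compat_l; [apply tmP_ge0|].
  replace ((1 - s) * w / 2 ^ mu) with ((1 - s) * w * s * (2 ^ la / t)).
  2:{ unfold s, V. field. lra. }
  rewrite <- (Rmult_1_l (2 ^ la / t)) at 2. apply Rmult_le_compat_r; [|exact Hmul].
  apply Rlt_le, Rdiv_lt_0_compat; lra.
Qed.

(** Indices start at 0; the maximum makes the term [k = 0] equal to 1, matching the places where a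
    trivial bound replaces [1 / k]. *)
Definition harmonic (n : nat) : R := sumR (fun k => / INR (Nat.max 1 k)) n.

Lemma harmonic_pow2 (n : nat) : harmonic (2 ^ n) <= INR n + 1.
Proof.
  unfold harmonic. induction n as [|n IH].
  - simpl. rewrite Rinv_1. lra.
  - replace (2 ^ S n)%nat with (2 ^ n + 2 ^ n)%nat by (simpl; lia).
    rewrite sumR_app, S_INR.
    assert (H : sumR (fun i => / INR (Nat.max 1 (2 ^ n + i))) (2 ^ n) <= INR (2 ^ n) * / INR (2 ^ n)).
    { apply sumR_bound. intros i _. assert (H := pow2_nz n).
      apply Rinv_le_contravar; [apply lt_0_INR; lia|apply le_INR; lia]. }
    rewrite Rinv_r in H; [lra|apply not_0_INR, pow2_nz].
Qed.

(** For [t = k 2^la + h] the product depends on [h] only, by periodicity, and the decay in [t] is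
    [1 / k]. Summation over [h] gives [tm_rho ^ la], over [k] a harmonic sum; the logarithm [mu + 1]
    is the whole price of the smoothing. *)
Lemma dft_tm_L1 (la mu : nat) :
  sumR (fun j => sumR (fun k =>
     Cmod (dft (tmg la mu) (2 ^ la * 2 ^ mu) (INR j - INR k))) (2 ^ la * 2 ^ mu)) (2 ^ la * 2 ^ mu)
  <= 2 ^ la * 2 ^ mu * (2 * ((INR mu + 1) * tm_rho ^ la)).
Proof.
  assert (H1 := pow2_gt0 la). assert (H2 := pow2_gt0 mu).
  eapply Rle_trans; [apply (sumR_diff_le (fun t => Cmod (dft (tmg la mu) (2 ^ la * 2 ^ mu) t)))|].
  { intros x; apply Cmod_dft_tm_opp. }
  { intros x; apply Cmod_ge_0. }
  rewrite INR_vol. set (V := 2 ^ la * 2 ^ mu).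
  replace (V * (2 * ((INR mu + 1) * tm_rho ^ la))) with (2 * (V * ((INR mu + 1) * tm_rho ^ la))) by ring.
  apply Rmult_le_compat_l; [lra|].
  rewrite (sumR_ext _ (fun t => V * ((1 - INR t / V) * Cmod (dft (tmg la mu) (2 ^ la * 2 ^ mu) (INR t))))).
  2:{ intros t _. unfold V. field. lra. }
  rewrite sumR_scal. apply Rmult_le_compat_l; [unfold V; nra|].
  rewrite Nat.mul_comm, sumR_block.
  apply Rle_trans with (sumR (fun k => tm_rho ^ la * / INR (Nat.max 1 k)) (2 ^ mu)).
  2:{ rewrite sumR_scal, Rmult_comm. apply Rmult_le_compat_r; [|apply harmonic_pow2].
      apply pow_le; unfold tm_rho; lra. }
  apply sumR_le. intros k Hk.
  apply Rle_trans with (sumR (fun h => / INR (Nat.max 1 k) * tmP la (INR h / 2 ^ la)) (2 ^ la)).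
  2:{ rewrite sumR_scal, Rmult_comm. apply Rmult_le_compat_r; [|apply tm_fourier_L1].
      apply Rlt_le, Rinv_0_lt_compat, lt_0_INR. lia. }
  apply sumR_le. intros h Hh. rewrite (Nat.mul_comm (2 ^ mu)).
  assert (HP : tmP la (INR (k * 2 ^ la + h) / 2 ^ la) = tmP la (INR h / 2 ^ la)).
  { rewrite plus_INR, mult_INR, INR_pow2.
    replace ((INR k * 2 ^ la + INR h) / 2 ^ la) with (INR h / 2 ^ la + INR k) by (field; lra).
    apply tmP_add_INR. }
  assert (Ht : INR (k * 2 ^ la + h) < V).
  { unfold V. rewrite <- INR_vol. apply lt_INR. nia. }
  assert (Ht0 := pos_INR (k * 2 ^ la + h)).
  destruct k as [|k].
  - change (Nat.max 1 0) with 1%nat. rewrite INR_1, Rinv_1, Rmult_1_l, <- HP.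
    assert (H3 := Cmod_dft_tm_le la mu (INR (0 * 2 ^ la + h))).
    assert (H4 := Cmod_ge_0 (dft (tmg la mu) (2 ^ la * 2 ^ mu) (INR (0 * 2 ^ la + h)))).
    assert (H5 : 0 <= INR (0 * 2 ^ la + h) / V).
    { apply Rmult_le_pos; [exact Ht0|]. apply Rlt_le, Rinv_0_lt_compat. unfold V; nra. }
    eapply Rle_trans; [|exact H3].
    set (w := Cmod _) in *. rewrite <- (Rmult_1_l w) at 2.
    apply Rmult_le_compat_r; lra.
  - assert (Hk1 : INR (S k) * 2 ^ la <= INR (S k * 2 ^ la + h)).
    { rewrite plus_INR, mult_INR, INR_pow2. pose proof (pos_INR h). lra. }
    assert (Hk0 : 0 < INR (S k)) by (apply lt_0_INR; lia).
    eapply Rle_trans; [apply Cmod_dft_tm_decay; unfold V in Ht; nra|].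
    rewrite HP, Rmult_comm. apply Rmult_le_compat_r; [apply tmP_ge0|].
    replace (Nat.max 1 (S k)) with (S k) by lia.
    replace (/ INR (S k)) with (2 ^ la / (INR (S k) * 2 ^ la)) by (field; lra).
    apply Rmult_le_compat_l; [lra|]. apply Rinv_le_contravar; nra.
Qed.

(* The Fejer mean of [psi (floor x mod 2^la)] over the grid of step [2^-mu]. *)
Definition tmG (la mu : nat) (x : R) : R :=
  sumR (fun u => tmg la mu u * fejer (2 ^ la * 2 ^ mu) (2 ^ mu * x - INR u)) (2 ^ la * 2 ^ mu).

Lemma fejer_periodic (n : nat) (y : R) : (0 < n)%nat -> fejer n (y - INR n) = fejer n y.
Proof.
  intros Hn. assert (INR n <> 0) by (apply not_0_INR; lia).
  unfold fejer. do 3 f_equal. apply sumC_ext. intros j _.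
  replace (INR j * ((y - INR n) / INR n)) with (INR j * (y / INR n) - INR j) by (field; assumption).
  apply e_sub_INR.
Qed.

Lemma vol_pos (la mu : nat) : (0 < 2 ^ la * 2 ^ mu)%nat.
Proof. assert (H1 := pow2_nz la). assert (H2 := pow2_nz mu). nia. Qed.

Lemma tmG_shift (la mu m : nat) (f : R) :
  tmG la mu (INR m + f) =
  sumR (fun i => psi ((m + i / 2 ^ mu) mod 2 ^ la) * fejer (2 ^ la * 2 ^ mu) (2 ^ mu * f - INR i))
    (2 ^ la * 2 ^ mu).
Proof.
  unfold tmG. rewrite <- (sumR_periodic _ _ (m * 2 ^ mu)).
  - apply sumR_ext. intros i _. rewrite tmg_add. do 2 f_equal.
    rewrite plus_INR, mult_INR, INR_pow2. ring.
  - intros i. rewrite tmg_periodic. f_equal.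
    rewrite plus_INR, <- (fejer_periodic _ (2 ^ mu * (INR m + f) - INR i)) by apply vol_pos.
    f_equal. ring.
Qed.

Lemma Rabs_psi_sub (m n : nat) : Rabs (psi m - psi n) <= 2.
Proof.
  unfold Rminus. eapply Rle_trans; [apply Rabs_triang|].
  rewrite Rabs_Ropp, !Rabs_psi. lra.
Qed.

(** By the partition of unity the error is an average of differences of signs, and these vanish at
    the grid points of the unit interval starting at [m]. All other points are at cyclic distance at
    least [2^mu d], where the kernel decays quadratically. *)
Lemma tmG_error_dist (la mu m : nat) (f d : R) :
  0 <= d -> d <= f -> d <= 1 - f ->
  Rabs (psi (m mod 2 ^ la) - tmG la mu (INR m + f)) <= 6 / Rmax 1 (2 ^ mu * d).
Proof.
  intros Hd Hdf Hdf1. rewrite tmG_shift.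
  assert (HV := vol_pos la mu). assert (H1 := pow2_gt0 la). assert (H2 := pow2_gt0 mu).
  set (V := (2 ^ la * 2 ^ mu)%nat) in *.
  set (y := 2 ^ mu * f).
  replace (psi (m mod 2 ^ la)) with (sumR (fun i => psi (m mod 2 ^ la) * fejer V (y - INR i)) V)
    by (rewrite sumR_scal, fejer_partition by exact HV; ring).
  set (D := fun i => Rabs (psi (m mod 2 ^ la) - psi ((m + i / 2 ^ mu) mod 2 ^ la)) * fejer V (y - INR i)).
  apply Rle_trans with (sumR D V).
  { match goal with |- Rabs (?a - ?b) <= _ => replace (a - b) with (a + (-1) * b) by ring end.
    rewrite <- sumR_scal, <- sumR_plus. eapply Rle_trans; [apply sumR_Rabs|].
    apply sumR_le. intros i _. unfold D. rewrite <- (Rabs_pos_eq (fejer V (y - INR i))) at 3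
      by apply fejer_ge0.
    rewrite <- Rabs_mult. right. f_equal. ring. }
  unfold Rmax. destruct (Rle_dec 1 (2 ^ mu * d)) as [Hc|Hc].
  2:{ apply Rle_trans with (sumR (fun i => 2 * fejer V (y - INR i)) V).
      - apply sumR_le. intros i _. unfold D. apply Rmult_le_compat_r; [apply fejer_ge0|apply Rabs_psi_sub].
      - rewrite sumR_scal, fejer_partition by exact HV. lra. }
  assert (Hla : (1 <= 2 ^ la)%nat) by (assert (H := pow2_nz la); lia).
  set (n := (V - 2 ^ mu)%nat).
  assert (Hn : V = (2 ^ mu + n)%nat) by (unfold n, V; nia).
  assert (HnR : INR V = 2 ^ mu + INR n) by (rewrite Hn, plus_INR, INR_pow2; reflexivity).
  rewrite Hn, sumR_app.
  rewrite (sumR_ext D (fun _ => 0)).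
  2:{ intros i Hi. unfold D. rewrite Nat.div_small by exact Hi. rewrite Nat.add_0_r.
      rewrite Rminus_diag, Rabs_R0. ring. }
  rewrite sumR_const, Rmult_0_r, Rplus_0_l.
  set (d2 := 2 ^ mu * (1 - f)).
  assert (Hd2 : 2 ^ mu * d <= d2) by (unfold d2; nra).
  assert (Hy : 2 ^ mu * d <= y) by (unfold y; nra).
  (* The two denominators are the distances to the grid point going right and going left around the
     period. The sums give [4 / d2] and [2 / y], which is the constant 6. *)
  apply Rle_trans with (sumR (fun i => 2 * / (d2 + INR i) ^ 2 + 2 * / (y + 1 + INR (n - 1 - i)) ^ 2) n).
  { apply sumR_le. intros i Hi. unfold D.
    assert (Hi' : INR (n - 1 - i) = INR n - 1 - INR i).
    { rewrite !minus_INR by lia. reflexivity. }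
    replace (y - INR (2 ^ mu + i)) with (- (d2 + INR i))
      by (rewrite plus_INR, INR_pow2; unfold y, d2; ring).
    assert (Hb := fejer_opp_le V (d2 + INR i)).
    replace (INR V - (d2 + INR i)) with (y + 1 + INR (n - 1 - i)) in Hb
      by (rewrite HnR, Hi'; unfold y, d2; ring).
    assert (Hi0 := pos_INR i). assert (Hj0 := pos_INR (n - 1 - i)).
    assert (Hrange : 0 < d2 + INR i < INR V).
    { split; [lra|]. rewrite HnR. rewrite Hi' in Hj0. unfold d2, y in *. nra. }
    apply Hb in Hrange.
    assert (Hpsi := Rabs_psi_sub (m mod 2 ^ la) ((m + (2 ^ mu + i) / 2 ^ mu) mod 2 ^ la)).
    assert (Hf := fejer_ge0 V (- (d2 + INR i))).
    apply Rle_trans with (2 * fejer V (- (d2 + INR i))); [now apply Rmult_le_compat_r|lra]. }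
  rewrite sumR_plus, !sumR_scal.
  rewrite (sumR_rev (fun i => / (y + 1 + INR i) ^ 2) n).
  assert (HA := sum_inv_sq d2 n ltac:(lra)).
  assert (HB := sum_inv_sq_succ y n ltac:(lra)).
  assert (HC : / d2 <= / (2 ^ mu * d)) by (apply Rinv_le_contravar; lra).
  assert (HE : / y <= / (2 ^ mu * d)) by (apply Rinv_le_contravar; lra).
  assert (HF : / d2 ^ 2 <= / d2) by (apply Rinv_le_contravar; nra).
  unfold Rdiv. lra.
Qed.

(** * Domination of the smoothing error by Fejer kernels *)

Definition fejW (n : nat) (x : R) : R := Cmod (sumC (fun j => e (INR j * x)) n) ^ 2.

Lemma fejW_ge0 (n : nat) (x : R) : 0 <= fejW n x.
Proof. apply pow2_ge_0. Qed.

Lemma sumC_Re (f : nat -> C) (n : nat) : Re (sumC f n) = sumR (fun i => Re (f i)) n.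
Proof. induction n as [|n IH]; simpl; [reflexivity|]. now rewrite <- IH. Qed.

(** The hypothesis on cosines expresses that [x] is [d] or [-d] modulo 1 and treats both signs at
    once. The angle is at most [PI / 4], below [PI / 3]. *)
Lemma Re_e_near (j : nat) (x d : R) : (forall i : nat, Re (e (INR i * x)) = cos (2 * PI * (INR i * d))) ->
  0 <= d -> INR j * d <= / 8 -> / 2 <= Re (e (INR j * x)).
Proof.
  intros H Hd Hj. replace (/ 2) with (1 / 2) by lra. rewrite H, <- cos_PI3. pose proof PI_RGT_0. assert (Hj0 := pos_INR j).
  assert (Ht : 0 <= INR j * d) by (now apply Rmult_le_pos).
  set (t := INR j * d) in *. apply cos_decr_1; nra.
Qed.

Lemma fejW_lower (n : nat) (x d : R) :
  (forall i : nat, Re (e (INR i * x)) = cos (2 * PI * (INR i * d))) ->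
  0 <= d -> INR n * d <= / 8 -> INR n ^ 2 / 4 <= fejW n x.
Proof.
  intros H Hd Hn. unfold fejW.
  assert (H1 := re_le_Cmod (sumC (fun j => e (INR j * x)) n)).
  assert (H2 : INR n * / 2 <= Re (sumC (fun j => e (INR j * x)) n)).
  { rewrite sumC_Re, <- sumR_const. apply sumR_le. intros j Hj.
    apply (Re_e_near j x d); [exact H|exact Hd|].
    apply Rle_trans with (INR n * d); [|exact Hn].
    apply Rmult_le_compat_r; [exact Hd|]. apply le_INR; lia. }
  assert (H3 := Rle_abs (Re (sumC (fun j => e (INR j * x)) n))).
  assert (H4 := pos_INR n).
  apply Rle_trans with ((INR n * / 2) ^ 2); [right; field|].
  apply pow_incr. lra.
Qed.

(** The scale with [2^i d] between 1/16 and 1/8, clipped to the range from 0 to [mu]. *)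
Lemma dyadic_scale (d : R) (mu : nat) :
  exists i, (i <= mu)%nat /\ (i = 0%nat \/ 2 ^ i * d <= / 8) /\ (i = mu \/ / 16 < 2 ^ i * d).
Proof.
  induction mu as [|mu [i [H1 [H2 H3]]]].
  - exists 0%nat. auto.
  - destruct H3 as [H3|H3].
    + subst i. destruct (Rle_dec (2 ^ S mu * d) (/ 8)) as [H|H].
      * exists (S mu). auto.
      * exists mu. simpl in H. repeat split; [lia|exact H2|right; lra].
    + exists i. repeat split; [lia|exact H2|now right].
Qed.

(** At distance [d] from the integers, the kernel of length [2^i] with [2^i] near [1 / (8 d)] is
    still at least a quarter of its peak [4^i]. Divided by [2^mu 2^i] it dominates [1 / (2^mu d)];
    adding all scales makes the bound independent of [d], hence a trigonometric polynomial in
    [x]. *)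
Lemma tmG_error (la mu m : nat) (f : R) : 0 <= f <= 1 ->
  Rabs (psi (m mod 2 ^ la) - tmG la mu (INR m + f))
  <= 384 * sumR (fun i => fejW (2 ^ i) (INR m + f) / (2 ^ mu * 2 ^ i)) (S mu).
Proof.
  intros Hf. set (x := INR m + f). set (d := Rmin f (1 - f)).
  assert (Hd : 0 <= d) by (unfold d; apply Rmin_glb; lra).
  assert (Hcos : forall i : nat, Re (e (INR i * x)) = cos (2 * PI * (INR i * d))).
  { intros i. unfold x, d, Rmin. destruct (Rle_dec f (1 - f)).
    - rewrite Rmult_plus_distr_l, Rplus_comm, <- mult_INR, e_add_INR. reflexivity.
    - replace (INR i * (INR m + f)) with (- (INR i * (1 - f)) + INR (i * S m))
        by (rewrite mult_INR, S_INR; ring).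
      rewrite e_add_INR, e_opp, re_conj. reflexivity. }
  assert (He := tmG_error_dist la mu m f d Hd (Rmin_l _ _) (Rmin_r _ _)). fold x in He.
  eapply Rle_trans; [exact He|].
  destruct (dyadic_scale d mu) as [i [Hi [H1 H2]]].
  assert (Pmu := pow2_gt0 mu). assert (Pi := pow2_gt0 i).
  assert (HW : (2 ^ i) ^ 2 / 4 <= fejW (2 ^ i) x).
  { destruct H1 as [H1|H1].
    - subst i. unfold fejW. simpl sumC. simpl INR. rewrite Rmult_0_l, e_0, Cplus_0_l, Cmod_1. simpl. lra.
    - rewrite <- INR_pow2. apply fejW_lower with d; [exact Hcos|exact Hd|now rewrite INR_pow2]. }
  (* [96 = 6 * 16] comes from [2^i d > 1/16]; the factor 4 lost in [HW] turns it into 384. *)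
  assert (Hmax : 6 / Rmax 1 (2 ^ mu * d) <= 96 * (2 ^ i / 2 ^ mu)).
  { assert (HM : 0 < Rmax 1 (2 ^ mu * d)) by (pose proof (Rmax_l 1 (2 ^ mu * d)); lra).
    apply Rmult_le_reg_r with (Rmax 1 (2 ^ mu * d)); [exact HM|].
    unfold Rdiv at 1. rewrite Rmult_assoc, Rinv_l, Rmult_1_r by lra.
    destruct H2 as [H2|H2].
    - subst i. unfold Rdiv. rewrite Rinv_r by lra. pose proof (Rmax_l 1 (2 ^ mu * d)). lra.
    - pose proof (Rmax_r 1 (2 ^ mu * d)) as H3.
      apply Rle_trans with (96 * (2 ^ i / 2 ^ mu) * (2 ^ mu * d)).
      + replace (96 * (2 ^ i / 2 ^ mu) * (2 ^ mu * d)) with (96 * (2 ^ i * d)) by (field; lra). lra.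
      + apply Rmult_le_compat_l; [|exact H3].
        assert (0 < 2 ^ i / 2 ^ mu) by (now apply Rdiv_lt_0_compat). lra. }
  eapply Rle_trans; [exact Hmax|].
  apply Rle_trans with (384 * (fejW (2 ^ i) x / (2 ^ mu * 2 ^ i))).
  - replace (96 * (2 ^ i / 2 ^ mu)) with (384 * (((2 ^ i) ^ 2 / 4) / (2 ^ mu * 2 ^ i))) by (field; lra).
    apply Rmult_le_compat_l; [lra|]. apply Rmult_le_compat_r; [|exact HW].
    apply Rlt_le, Rinv_0_lt_compat. nra.
  - apply Rmult_le_compat_l; [lra|].
    apply (sumR_term_le (fun i => fejW (2 ^ i) x / (2 ^ mu * 2 ^ i))); [lia|].
    intros k _. apply Rmult_le_pos; [apply fejW_ge0|].
    apply Rlt_le, Rinv_0_lt_compat. pose proof (pow2_gt0 k). nra.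
Qed.

(** * Reduction to exponential sums over short blocks *)

Lemma floor_nat_spec (x : R) : 0 <= x ->
  INR (floor_nat x) <= x < INR (floor_nat x) + 1.
Proof.
  intros Hx. unfold floor_nat. destruct (base_Int_part x) as [H1 H2].
  assert (H3 : (0 <= Int_part x)%Z).
  { apply Z.lt_succ_r, lt_IZR. rewrite succ_IZR. lra. }
  rewrite INR_IZR_INZ, Z2Nat.id by exact H3. lra.
Qed.

Lemma floor_nat_mono (x y : R) : 0 <= x <= y -> (floor_nat x <= floor_nat y)%nat.
Proof.
  intros H. assert (H1 := floor_nat_spec x ltac:(lra)). assert (H2 := floor_nat_spec y ltac:(lra)).
  apply Nat.lt_succ_r, INR_lt. rewrite S_INR. lra.
Qed.

Lemma monotone_split (P : nat -> Prop) (n : nat) :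
  (forall j, P j \/ ~ P j) -> (forall i j, (i <= j)%nat -> (j < n)%nat -> P i -> P j) ->
  exists s, (s <= n)%nat /\ (forall j, (j < s)%nat -> ~ P j) /\
            (forall j, (s <= j)%nat -> (j < n)%nat -> P j).
Proof.
  intros Hdec. induction n as [|n IH]; intros Hm.
  - exists 0%nat. repeat split; intros; lia.
  - destruct IH as [s [H1 [H2 H3]]]; [intros i j Hij Hj; apply Hm; lia|].
    destruct (Nat.eq_dec s n) as [E|E].
    + destruct (Hdec n) as [Hn|Hn].
      * exists s. repeat split; [lia|exact H2|]. intros j Hj Hj2.
        replace j with n by lia. exact Hn.
      * exists (S n). repeat split; [lia| |intros; lia].
        intros j Hj. destruct (Nat.eq_dec j n); [now subst j|apply H2; lia].
    + exists s. repeat split; [lia|exact H2|]. intros j Hj Hj2.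
      apply (Hm s j Hj Hj2), H3; lia.
Qed.

Lemma Cmod_sum_e_opp (x : nat -> R) (n : nat) :
  Cmod (sumC (fun r => e (- x r)) n) = Cmod (sumC (fun r => e (x r)) n).
Proof.
  rewrite <- (Cmod_conj (sumC (fun r => e (x r)) n)), sumC_conj. f_equal.
  apply sumC_ext. intros; apply e_opp.
Qed.

Lemma tmG_sum_bound (la mu : nat) (x : nat -> R) (n : nat) :
  Rabs (sumR (fun r => tmG la mu (x r)) n) <=
  / (2 ^ la * 2 ^ mu) * sumR (fun j => sumR (fun k =>
     Cmod (dft (tmg la mu) (2 ^ la * 2 ^ mu) (INR j - INR k)) *
     Cmod (sumC (fun r => e ((INR j - INR k) / 2 ^ la * x r)) n)) (2 ^ la * 2 ^ mu)) (2 ^ la * 2 ^ mu).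
Proof.
  assert (H1 := pow2_gt0 la). assert (H2 := pow2_gt0 mu).
  set (V := (2 ^ la * 2 ^ mu)%nat).
  assert (HV : INR V = 2 ^ la * 2 ^ mu) by apply INR_vol.
  rewrite <- Cmod_R, <- sumC_RtoC.
  rewrite (sumC_ext _ (fun r => / RtoC (INR V) * sumC (fun j => sumC (fun k =>
      dft (tmg la mu) V (INR j - INR k) * e ((INR j - INR k) / 2 ^ la * x r)) V) V)%C).
  - rewrite sumC_scal, Cmod_mult, Cmod_inv, Cmod_R, Rabs_pos_eq, HV.
    + apply Rmult_le_compat_l; [apply Rlt_le, Rinv_0_lt_compat; nra|].
      rewrite sumC_swap. eapply Rle_trans; [apply sumC_Cmod|]. apply sumR_le. intros j _.
      rewrite sumC_swap. eapply Rle_trans; [apply sumC_Cmod|]. apply sumR_le. intros k _.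
      rewrite sumC_scal, Cmod_mult. lra.
    + apply pos_INR.
    + intros H. apply RtoC_inj in H. rewrite HV in H. nra.
  - intros r _. unfold tmG. fold V. rewrite fejer_interpolation by apply vol_pos.
    f_equal. apply sumC_ext. intros j _. apply sumC_ext. intros k _. do 2 f_equal.
    rewrite HV. field. lra.
Qed.

(** Opening the square, the [n] diagonal pairs contribute the number of points each. The
    off-diagonal pairs, fewer than [n^2], have a nonzero integer frequency, which conjugation makes
    positive. *)
Lemma fejW_sum_bound (n m K : nat) (x : nat -> nat -> R) (B : R) : 0 <= B ->
  (forall t, (1 <= t < n)%nat ->
     sumR (fun j => Cmod (sumC (fun r => e (INR t * x j r)) K)) m <= B) ->
  sumR (fun j => sumR (fun r => fejW n (x j r)) K) m <= INR n * (INR m * INR K) + INR n ^ 2 * B.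
Proof.
  intros HB H.
  assert (E : sumR (fun j => sumR (fun r => fejW n (x j r)) K) m =
    sumR (fun k => sumR (fun l => sumR (fun j => Re (sumC (fun r => e ((INR k - INR l) * x j r)) K)) m) n) n).
  { rewrite (sumR_ext _ (fun j => sumR (fun k => sumR (fun l =>
       Re (sumC (fun r => e ((INR k - INR l) * x j r)) K)) n) n)).
    - rewrite sumR_swap. apply sumR_ext. intros k _. apply sumR_swap.
    - intros j _.
      rewrite (sumR_ext _ (fun r => sumR (fun k => sumR (fun l => Re (e ((INR k - INR l) * x j r))) n) n)).
      + rewrite sumR_swap. apply sumR_ext. intros k _. rewrite sumR_swap.
        apply sumR_ext. intros l _. symmetry. apply sumC_Re.
      + intros r _. unfold fejW.
        assert (E := Cmod2_sum_e (fun i => INR i * x j r) n).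
        apply (f_equal Re) in E. rewrite re_RtoC in E. rewrite E, sumC_Re.
        apply sumR_ext. intros k _. rewrite sumC_Re. apply sumR_ext. intros l _.
        do 2 f_equal. ring. }
  rewrite E.
  assert (Hre : forall t : R, sumR (fun j => Re (sumC (fun r => e (t * x j r)) K)) m
     <= sumR (fun j => Cmod (sumC (fun r => e (t * x j r)) K)) m).
  { intros t. apply sumR_le. intros j _.
    eapply Rle_trans; [apply Rle_abs|apply re_le_Cmod]. }
  assert (Hjk : forall k l, (k < n)%nat -> (l < n)%nat ->
     sumR (fun j => Re (sumC (fun r => e ((INR k - INR l) * x j r)) K)) m
     <= (if Nat.eqb k l then INR m * INR K else 0) + B).
  { intros k l Hk Hl. eapply Rle_trans; [apply Hre|].
    destruct (Nat.eqb_spec k l) as [Ekl|Ekl].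
    - assert (Hb : sumR (fun j => Cmod (sumC (fun r => e ((INR k - INR l) * x j r)) K)) m
                   <= INR m * INR K); [|lra].
      apply sumR_bound. intros j _. apply (sumC_e_le (fun r => (INR k - INR l) * x j r)).
    - rewrite Rplus_0_l.
      assert (Hlt : (k < l \/ l < k)%nat) by lia. destruct Hlt as [Hlt|Hlt].
      + assert (Hb := H (l - k)%nat ltac:(lia)). rewrite minus_INR in Hb by lia.
        eapply Rle_trans; [|exact Hb]. right. apply sumR_ext. intros j _.
        rewrite <- Cmod_sum_e_opp. f_equal. apply sumC_ext. intros r _. f_equal. ring.
      + assert (Hb := H (k - l)%nat ltac:(lia)). now rewrite minus_INR in Hb by lia. }
  apply Rle_trans with (sumR (fun k => INR m * INR K + INR n * B) n).
  2:{ rewrite sumR_const. right; ring. }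
  apply sumR_le. intros k Hk.
  apply Rle_trans with (sumR (fun l => (if Nat.eqb k l then INR m * INR K else 0) + B) n).
  { apply sumR_le. intros l Hl. now apply Hjk. }
  rewrite sumR_plus, sumR_const. apply Rplus_le_compat_r.
  assert (Hd : forall n', (n' <= n)%nat -> sumR (fun l => if Nat.eqb k l then INR m * INR K else 0) n'
     <= if Nat.ltb k n' then INR m * INR K else 0).
  { induction n' as [|n' IH]; intros Hn'; [simpl; lra|]. cbn [sumR].
    assert (IH' := IH ltac:(lia)).
    destruct (Nat.eqb_spec k n'), (Nat.ltb_spec k n'), (Nat.ltb_spec k (S n')); try lia; lra. }
  assert (Hd' := Hd n (le_n n)). destruct (Nat.ltb_spec k n); [exact Hd'|lia].
Qed.

Lemma psi_sub_block (la mu : nat) (x : nat -> R) (q K : nat) (n : nat) (T : R) :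
  (forall r, (r < n)%nat -> 0 <= x r) ->
  (forall r, (r < n)%nat -> (floor_nat (x r) / 2 ^ la)%nat = q) ->
  Rabs (sumR (fun r => tmG la mu (x r)) n) <= T ->
  Rabs (sumR (fun r => psi (floor_nat (x r))) n) <=
  T + 384 * sumR (fun r => sumR (fun i => fejW (2 ^ i) (x r) / (2 ^ mu * 2 ^ i)) (S mu)) n.
Proof.
  intros Hx Hq HT.
  rewrite (sumR_ext _ (fun r => psi q * (tmG la mu (x r)
     + (psi (floor_nat (x r) mod 2 ^ la) - tmG la mu (x r))))).
  2:{ intros r Hr. rewrite (Nat.div_mod_eq (floor_nat (x r)) (2 ^ la)) at 1.
      rewrite Hq by exact Hr. rewrite Nat.mul_comm, psi_add_pow2; [ring|].
      apply Nat.mod_upper_bound, pow2_nz. }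
  rewrite sumR_scal, Rabs_mult, Rabs_psi, Rmult_1_l, sumR_plus.
  eapply Rle_trans; [apply Rabs_triang|]. apply Rplus_le_compat; [exact HT|].
  eapply Rle_trans; [apply sumR_Rabs|]. rewrite <- sumR_scal. apply sumR_le. intros r Hr.
  assert (Hs := floor_nat_spec (x r) (Hx r Hr)).
  assert (He := tmG_error la mu (floor_nat (x r)) (x r - INR (floor_nat (x r))) ltac:(lra)).
  replace (INR (floor_nat (x r)) + (x r - INR (floor_nat (x r)))) with (x r) in He by ring.
  exact He.
Qed.

(* The floors of one block meet at most two dyadic intervals of length [2^la]. *)
Lemma psi_block (la mu : nat) (x : nat -> R) (K len : nat) (T : R) :
  (len <= K)%nat ->
  (forall r, (r < K)%nat -> 0 <= x r) ->
  (forall r s, (r <= s)%nat -> (s < K)%nat -> x r <= x s) ->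
  (forall r, (r < K)%nat -> x r <= x 0%nat + 2 ^ la) ->
  (forall p n, (p + n <= K)%nat -> Rabs (sumR (fun r => tmG la mu (x (p + r)%nat)) n) <= T) ->
  Rabs (sumR (fun r => psi (floor_nat (x r))) len) <=
  2 * T + 384 * sumR (fun r => sumR (fun i => fejW (2 ^ i) (x r) / (2 ^ mu * 2 ^ i)) (S mu)) K.
Proof.
  intros Hlen Hx Hm Hd HT.
  set (E := fun r => sumR (fun i => fejW (2 ^ i) (x r) / (2 ^ mu * 2 ^ i)) (S mu)).
  assert (HE : forall r, 0 <= E r).
  { intros r. apply sumR_ge0. intros i _. apply Rmult_le_pos; [apply fejW_ge0|].
    apply Rlt_le, Rinv_0_lt_compat. pose proof (pow2_gt0 i). pose proof (pow2_gt0 mu). nra. }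
  assert (HT0 : 0 <= T).
  { eapply Rle_trans; [apply Rabs_pos|apply (HT 0%nat 0%nat); lia]. }
  set (q := (floor_nat (x 0%nat) / 2 ^ la)%nat).
  set (P := fun r => (q + 1 <= floor_nat (x r) / 2 ^ la)%nat).
  destruct (monotone_split P len) as [s [Hs [Hs1 Hs2]]].
  { intros j. unfold P. lia. }
  { intros i j Hij Hj. unfold P. intros Hi. eapply Nat.le_trans; [exact Hi|].
    apply Nat.Div0.div_le_mono, floor_nat_mono. split; [apply Hx; lia|apply Hm; lia]. }
  assert (Hfl : forall r, (r < K)%nat ->
     (q <= floor_nat (x r) / 2 ^ la <= q + 1)%nat).
  { intros r Hr. split.
    - apply Nat.Div0.div_le_mono, floor_nat_mono. split; [apply Hx; lia|apply Hm; lia].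
    - assert (H0 := floor_nat_spec (x 0%nat) (Hx 0%nat ltac:(lia))).
      assert (Hr1 := floor_nat_spec (x r) (Hx r Hr)).
      assert (Hle : (floor_nat (x r) <= floor_nat (x 0%nat) + 1 * 2 ^ la)%nat).
      { apply Nat.lt_succ_r, INR_lt. rewrite S_INR, plus_INR, Nat.mul_1_l, INR_pow2.
        assert (H3 := Hd r Hr). lra. }
      apply (Nat.Div0.div_le_mono _ _ (2 ^ la)) in Hle.
      rewrite Nat.div_add in Hle by apply pow2_nz. exact Hle. }
  replace len with (s + (len - s))%nat by lia. rewrite sumR_app.
  eapply Rle_trans; [apply Rabs_triang|].
  assert (H1 : Rabs (sumR (fun r => psi (floor_nat (x r))) s) <= T + 384 * sumR E s).
  { apply (psi_sub_block la mu x q K).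
    - intros r Hr. apply Hx; lia.
    - intros r Hr. assert (Ha := Hs1 r Hr). assert (Hb := Hfl r ltac:(lia)). unfold P in Ha. lia.
    - apply (HT 0%nat s); lia. }
  assert (H2 : Rabs (sumR (fun r => psi (floor_nat (x (s + r)%nat))) (len - s))
     <= T + 384 * sumR (fun r => E (s + r)%nat) (len - s)).
  { apply (psi_sub_block la mu (fun r => x (s + r)%nat) (q + 1) K).
    - intros r Hr. apply Hx; lia.
    - intros r Hr. assert (Ha := Hs2 (s + r)%nat ltac:(lia) ltac:(lia)).
      assert (Hb := Hfl (s + r)%nat ltac:(lia)). unfold P in Ha. lia.
    - apply HT; lia. }
  assert (H3 := sumR_app E s (len - s)).
  replace (s + (len - s))%nat with len in H3 by lia.
  assert (H4 := sumR_mono E len K Hlen (fun i _ => HE i)). lra.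
Qed.

Lemma sum_pow2_le (n : nat) : sumR (pow 2) (S n) <= 2 * 2 ^ n.
Proof. induction n as [|n IH]; [simpl; lra|]. cbn [sumR] in *. simpl pow. lra. Qed.

(* [b xi j] bounds the sums over block [j] at frequency [xi]; [tiny] absorbs the
   frequencies [xi < 1] for which only the decay of [tmP la xi] at [0] helps. *)
Lemma psi_blocks_bound (la mu K J : nat) (x : nat -> nat -> R) (b : R -> nat -> R)
  (len : nat -> nat) (B tiny : R) :
  0 <= B -> 0 <= tiny ->
  (forall j, (j < J)%nat -> (len j <= K)%nat) ->
  (forall j r, (j < J)%nat -> (r < K)%nat -> 0 <= x j r) ->
  (forall j r s, (j < J)%nat -> (r <= s)%nat -> (s < K)%nat -> x j r <= x j s) ->
  (forall j r, (j < J)%nat -> (r < K)%nat -> x j r <= x j 0%nat + 2 ^ la) ->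
  (forall xi j p n, 0 <= xi <= 2 ^ mu -> (j < J)%nat -> (p + n <= K)%nat ->
     Cmod (sumC (fun r => e (xi * x j (p + r)%nat)) n) <= b xi j) ->
  (forall xi, 0 <= xi <= 2 ^ mu -> tmP la xi * sumR (b xi) J <= tmP la xi * B + tiny) ->
  (forall xi, 1 <= xi <= 2 ^ mu -> sumR (b xi) J <= B) ->
  sumR (fun j => Rabs (sumR (fun r => psi (floor_nat (x j r))) (len j))) J <=
  4 * (INR mu + 1) * tm_rho ^ la * B + 2 * (2 ^ la * 2 ^ mu) * tiny
  + 384 * ((INR mu + 1) * (INR J * INR K) / 2 ^ mu + 2 * B).
Proof.
  intros HB Ht Hlen Hx Hm Hd Hb Hsmall Hbig.
  assert (H1 := pow2_gt0 la). assert (H2 := pow2_gt0 mu).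
  set (V := (2 ^ la * 2 ^ mu)%nat).
  assert (HV : INR V = 2 ^ la * 2 ^ mu) by apply INR_vol.
  (* Opposite frequencies give conjugate sums and equal products, so nonnegative ones suffice. *)
  set (xi := fun j k : nat => Rabs (INR j - INR k) / 2 ^ la).
  assert (Hxi : forall j k, (j < V)%nat -> (k < V)%nat -> 0 <= xi j k <= 2 ^ mu).
  { intros j k Hj Hk. unfold xi. apply lt_INR in Hj, Hk. rewrite HV in Hj, Hk.
    assert (Hj0 := pos_INR j). assert (Hk0 := pos_INR k).
    assert (Ha : 0 <= Rabs (INR j - INR k) <= 2 ^ la * 2 ^ mu).
    { split; [apply Rabs_pos|apply Rabs_le; lra]. }
    split; [apply Rmult_le_pos; [lra|apply Rlt_le, Rinv_0_lt_compat; lra]|].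
    apply Rmult_le_reg_r with (2 ^ la); [exact H1|]. unfold Rdiv.
    rewrite Rmult_assoc, Rinv_l; lra. }
  set (D := fun j k : nat => Cmod (dft (tmg la mu) V (INR j - INR k))).
  set (T := fun i => / (2 ^ la * 2 ^ mu) * sumR (fun j => sumR (fun k => D j k * b (xi j k) i) V) V).
  set (E := fun j r => sumR (fun i => fejW (2 ^ i) (x j r) / (2 ^ mu * 2 ^ i)) (S mu)).
  apply Rle_trans with (sumR (fun j => 2 * T j + 384 * sumR (E j) K) J).
  { apply sumR_le. intros j Hj. apply (psi_block la mu (x j) K (len j) (T j)).
    - now apply Hlen.
    - intros; now apply Hx.
    - intros; now apply Hm.
    - intros; now apply Hd.
    - intros p n Hpn. eapply Rle_trans; [apply tmG_sum_bound|].
      apply Rmult_le_compat_l; [apply Rlt_le, Rinv_0_lt_compat; nra|].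
      apply sumR_le. intros a Ha. apply sumR_le. intros k Hk.
      apply Rmult_le_compat_l; [apply Cmod_ge_0|].
      eapply Rle_trans; [|apply (Hb (xi a k) j p n (Hxi a k Ha Hk) Hj Hpn)].
      unfold xi, Rabs. destruct (Rcase_abs (INR a - INR k)) as [Hneg|Hneg].
      + right. rewrite <- Cmod_sum_e_opp. f_equal. apply sumC_ext. intros r _. f_equal.
        unfold Rdiv. ring.
      + right. reflexivity. }
  rewrite sumR_plus, !sumR_scal.
  assert (HTs : sumR T J <= 2 * ((INR mu + 1) * tm_rho ^ la) * B + 2 ^ la * 2 ^ mu * tiny).
  { unfold T. rewrite sumR_scal.
    apply Rmult_le_reg_l with (2 ^ la * 2 ^ mu); [nra|].
    rewrite <- Rmult_assoc, Rinv_r, Rmult_1_l by nra.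
    (* The blocks are now added at fixed [(j, k)]; as the result is uniform in the frequency, only
       the L1 norm of the coefficients remains. *)
    rewrite sumR_swap.
    apply Rle_trans with (sumR (fun j => sumR (fun k => D j k * B + tiny) V) V).
    - apply sumR_le. intros j Hj. rewrite sumR_swap. apply sumR_le. intros k Hk.
      rewrite sumR_scal. change (sumR (fun i => b (xi j k) i) J) with (sumR (b (xi j k)) J).
      assert (Hs := Hsmall (xi j k) (Hxi j k Hj Hk)).
      unfold D, V. rewrite Cmod_dft_tm.
      replace (tmP la ((INR j - INR k) / 2 ^ la)) with (tmP la (xi j k)).
      2:{ unfold xi, Rabs. destruct (Rcase_abs (INR j - INR k)); [|reflexivity].
          rewrite <- tmP_opp. f_equal. unfold Rdiv; ring. }
      assert (Hw := sumC_e_le (fun w => INR w * - ((INR j - INR k) / (2 ^ la * 2 ^ mu))) (2 ^ mu)).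
      rewrite INR_pow2 in Hw. set (w := Cmod _) in *.
      assert (Hw0 : 0 <= w) by apply Cmod_ge_0.
      assert (Hq : 0 <= w / 2 ^ mu <= 1).
      { split; [apply Rmult_le_pos; [exact Hw0|apply Rlt_le, Rinv_0_lt_compat; lra]|].
        apply Rmult_le_reg_r with (2 ^ mu); [exact H2|]. unfold Rdiv.
        rewrite Rmult_assoc, Rinv_l; lra. }
      set (q := w / 2 ^ mu) in *. set (S0 := sumR (b (xi j k)) J) in *.
      apply Rle_trans with (q * (tmP la (xi j k) * B + tiny)).
      + replace (tmP la (xi j k) * q * S0) with (q * (tmP la (xi j k) * S0)) by ring.
        apply Rmult_le_compat_l; lra.
      + assert (q * tiny <= 1 * tiny) by (apply Rmult_le_compat_r; lra).
        rewrite Rmult_plus_distr_l. lra.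
    - assert (HL := dft_tm_L1 la mu). fold V in HL.
      rewrite (sumR_ext _ (fun j => B * sumR (fun k => D j k) V + INR V * tiny)).
      2:{ intros j _. rewrite sumR_plus, sumR_const, <- sumR_scal. f_equal.
          apply sumR_ext. intros; ring. }
      rewrite sumR_plus, sumR_scal, sumR_const, HV.
      apply (Rmult_le_compat_l B) in HL; [|exact HB]. unfold D. lra. }
  assert (HEs : sumR (fun j => sumR (E j) K) J <= (INR mu + 1) * (INR J * INR K) / 2 ^ mu + 2 * B).
  { unfold E.
    rewrite (sumR_ext _ (fun j => sumR (fun i => / (2 ^ mu * 2 ^ i) * sumR (fun r => fejW (2 ^ i) (x j r)) K) (S mu))).
    2:{ intros j _. rewrite sumR_swap. apply sumR_ext. intros i _.
        rewrite <- sumR_scal. apply sumR_ext. intros r _. unfold Rdiv; ring. }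
    rewrite sumR_swap.
    (* Each of the [mu + 1] scales has the same diagonal part, while the off-diagonal parts form a
       geometric series dominated by its last term. *)
    apply Rle_trans with (sumR (fun i => INR J * INR K / 2 ^ mu + B / 2 ^ mu * 2 ^ i) (S mu)).
    - apply sumR_le. intros i Hi. rewrite sumR_scal. assert (H3 := pow2_gt0 i).
      assert (Hf := fejW_sum_bound (2 ^ i) J K x B HB).
      rewrite INR_pow2 in Hf.
      apply Rle_trans with (/ (2 ^ mu * 2 ^ i) * (2 ^ i * (INR J * INR K) + (2 ^ i) ^ 2 * B)).
      + apply Rmult_le_compat_l; [apply Rlt_le, Rinv_0_lt_compat; nra|]. apply Hf.
        intros t Htt.
        assert (Htr : 1 <= INR t <= 2 ^ mu).
        { split; [apply (le_INR 1); lia|]. rewrite <- INR_pow2. apply le_INR.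
          apply Nat.le_trans with (2 ^ i)%nat; [lia|apply Nat.pow_le_mono_r; lia]. }
        eapply Rle_trans; [|apply (Hbig (INR t) Htr)]. apply sumR_le. intros j Hj.
        apply (Hb (INR t) j 0%nat K); [lra|exact Hj|lia].
      + right. field. lra.
    - rewrite sumR_plus, sumR_const, sumR_scal, S_INR.
      assert (Hp := sum_pow2_le mu).
      apply (Rmult_le_compat_l (B / 2 ^ mu)) in Hp.
      2:{ apply Rmult_le_pos; [exact HB|apply Rlt_le, Rinv_0_lt_compat; lra]. }
      replace (B / 2 ^ mu * (2 * 2 ^ mu)) with (2 * B) in Hp by (field; lra).
      unfold Rdiv in *. lra. }
  lra.
Qed.

(** * Exponential sums over short blocks *)

(* [min (K, 1 / d)] for [d >= 0], without a special case at [d = 0]. *)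
Definition cap (K d : R) : R := / Rmax (/ K) d.

Lemma cap_den_pos (K d : R) : 0 < K -> 0 < Rmax (/ K) d.
Proof. intros HK. pose proof (Rmax_l (/ K) d). pose proof (Rinv_0_lt_compat K HK). lra. Qed.

Lemma cap_ge0 (K d : R) : 0 < K -> 0 <= cap K d.
Proof. intros HK. apply Rlt_le, Rinv_0_lt_compat, cap_den_pos, HK. Qed.

Lemma cap_le_K (K d : R) : 0 < K -> cap K d <= K.
Proof.
  intros HK. rewrite <- (Rinv_inv K) at 2. apply Rinv_le_contravar; [now apply Rinv_0_lt_compat|apply Rmax_l].
Qed.

Lemma cap_le_inv (K d : R) : 0 < d -> cap K d <= / d.
Proof. intros Hd. apply Rinv_le_contravar; [exact Hd|apply Rmax_r]. Qed.

Lemma cap_anti (K d d' : R) : 0 < K -> d <= d' -> cap K d' <= cap K d.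
Proof.
  intros HK Hd. apply Rinv_le_contravar; [now apply cap_den_pos|].
  apply Rle_max_compat_l, Hd.
Qed.

Lemma le_cap (K d w : R) : 0 < K -> 0 <= w -> w <= K -> w * d <= 1 -> w <= cap K d.
Proof.
  intros HK Hw H1 H2. assert (Hp := cap_den_pos K d HK).
  apply Rmult_le_reg_r with (Rmax (/ K) d); [exact Hp|].
  unfold cap. rewrite Rinv_l by lra. unfold Rmax. destruct (Rle_dec (/ K) d); [exact H2|].
  apply Rmult_le_reg_r with K; [exact HK|]. rewrite Rmult_assoc, Rinv_l; lra.
Qed.

Lemma geom_sum_cap (y : R) (z K n : nat) : (0 < K)%nat -> (n <= K)%nat ->
  Rabs (y - INR z) <= / 2 ->
  Cmod (sumC (fun r => e (INR r * y)) n) <= cap (INR K) (Rabs (y - INR z)).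
Proof.
  intros HK Hn Hz. set (s := y - INR z) in *.
  assert (HKr : 0 < INR K) by (now apply lt_0_INR).
  rewrite (sumC_ext _ (fun r => e (INR r * s))).
  2:{ intros r _. unfold s. rewrite <- (e_add_INR (INR r * (y - INR z)) (r * z)).
      f_equal. rewrite mult_INR. ring. }
  apply le_cap; [exact HKr|apply Cmod_ge_0| |].
  - eapply Rle_trans; [apply (sumC_e_le (fun r => INR r * s))|now apply le_INR].
  - eapply Rle_trans; [|apply (geom_sum_e_bound s n)].
    apply Rmult_le_compat_l; [apply Cmod_ge_0|].
    unfold Rabs in Hz at 1. unfold Rabs at 1. destruct (Rcase_abs s) as [H|H].
    + assert (H1 := sin_PI_ge (- s) ltac:(lra)).
      replace (PI * - s) with (- (PI * s)) in H1 by ring. rewrite sin_neg in H1.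
      rewrite <- Rabs_Ropp. eapply Rle_trans; [exact H1|apply Rle_abs].
    + assert (H1 := sin_PI_ge s ltac:(lra)).
      eapply Rle_trans; [exact H1|apply Rle_abs].
Qed.

Lemma nearest_nat (y : R) : 0 <= y ->
  exists z : nat, Rabs (y - INR z) <= / 2 /\ INR z <= y + / 2.
Proof.
  intros Hy. exists (floor_nat (y + / 2)).
  assert (H := floor_nat_spec (y + / 2) ltac:(lra)). split; [apply Rabs_le|]; lra.
Qed.

Lemma sum_cap_arith (K d : R) (n J : nat) : 0 < K -> 0 < d -> (n <= J)%nat ->
  sumR (fun i => cap K (INR i * d)) n <= K + harmonic J / d.
Proof.
  intros HK Hd Hn.
  apply Rle_trans with (sumR (fun i => cap K (INR i * d)) J).
  { apply sumR_mono; [exact Hn|]. intros; now apply cap_ge0. }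
  assert (H : forall m, sumR (fun i => cap K (INR i * d)) m <= K + harmonic m / d); [|apply H].
  intros m. destruct m as [|m].
  - unfold harmonic; simpl. unfold Rdiv. lra.
  - unfold harmonic. rewrite !sumR_shift. change (Nat.max 1 0) with 1%nat. rewrite INR_1, Rinv_1.
    assert (H0 := cap_le_K K (INR 0 * d) HK).
    assert (Hi : 0 < / d) by now apply Rinv_0_lt_compat.
    assert (H1 : sumR (fun i => cap K (INR (S i) * d)) m
       <= sumR (fun i => / INR (Nat.max 1 (S i))) m / d).
    { unfold Rdiv. rewrite Rmult_comm, <- sumR_scal. apply sumR_le. intros i _.
      replace (Nat.max 1 (S i)) with (S i) by lia.
      assert (Hs : 0 < INR (S i)) by (apply lt_0_INR; lia).
      rewrite <- Rinv_mult, Rmult_comm. apply cap_le_inv. now apply Rmult_lt_0_compat. }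
    unfold Rdiv in *. lra.
Qed.

Lemma spaced_gap (y : nat -> R) (J : nat) (d : R) :
  (forall j, (S j < J)%nat -> d <= y (S j) - y j) ->
  forall i a, (a + i < J)%nat -> INR i * d <= y (a + i)%nat - y a.
Proof.
  intros H i a. induction i as [|i IH]; intros Hi.
  - simpl. rewrite Nat.add_0_r. lra.
  - rewrite S_INR, Nat.add_succ_r. assert (H1 := H (a + i)%nat ltac:(lia)).
    assert (H2 := IH ltac:(lia)). lra.
Qed.

(** On each side of [z], counting away from [z] with the closest point as number 0, the point number
    [i] is at distance at least [i d]. The closest one costs [K], the others a harmonic sum. *)
Lemma spaced_sum (y : nat -> R) (J : nat) (K d z : R) : 0 < K -> 0 < d ->
  (forall j, (S j < J)%nat -> d <= y (S j) - y j) ->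
  sumR (fun j => cap K (Rabs (y j - z))) J <= 2 * (K + harmonic J / d).
Proof.
  intros HK Hd Hy. assert (Hg := spaced_gap y J d Hy).
  destruct (monotone_split (fun j => z <= y j) J) as [s [Hs [H1 H2]]].
  { intros j. destruct (Rle_dec z (y j)); [now left|now right]. }
  { intros i j Hij Hj Hi. assert (H := Hg (j - i)%nat i).
    replace (i + (j - i))%nat with j in H by lia.
    assert (H3 := pos_INR (j - i)). specialize (H Hj). nra. }
  replace J with (s + (J - s))%nat at 1 by lia. rewrite sumR_app.
  rewrite <- (sumR_rev _ s).
  assert (HA : sumR (fun i => cap K (Rabs (y (s - 1 - i)%nat - z))) s <= K + harmonic J / d).
  { eapply Rle_trans; [|apply (sum_cap_arith K d s J HK Hd Hs)]. apply sumR_le. intros i Hi.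
    apply cap_anti; [exact HK|].
    assert (H3 := H1 (s - 1)%nat ltac:(lia)). assert (H := Hg i (s - 1 - i)%nat).
    replace (s - 1 - i + i)%nat with (s - 1)%nat in H by lia. specialize (H ltac:(lia)).
    assert (H4 := pos_INR i). rewrite Rabs_left1 by nra. lra. }
  assert (HB : sumR (fun i => cap K (Rabs (y (s + i)%nat - z))) (J - s) <= K + harmonic J / d).
  { eapply Rle_trans; [|apply (sum_cap_arith K d (J - s) J HK Hd); lia]. apply sumR_le. intros i Hi.
    apply cap_anti; [exact HK|].
    assert (H3 := H2 s ltac:(lia) ltac:(lia)). assert (H := Hg i s ltac:(lia)).
    assert (H4 := pos_INR i). rewrite Rabs_pos_eq by nra. lra. }
  lra.
Qed.

(** * Partial summation, power functions, and the sum over one block *)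

Lemma abel_summation (u v : nat -> C) (n : nat) :
  sumC (fun i => u i * v i)%C n =
  (sumC u n * v n - sumC (fun i => sumC u (S i) * (v (S i) - v i)) n)%C.
Proof.
  induction n as [|n IH]; [simpl; ring|].
  cbn [sumC] in *. rewrite IH. ring.
Qed.

Lemma abel_bound (u v : nat -> C) (n : nat) (B : R) : 
  (forall m, (m <= n)%nat -> Cmod (sumC u m) <= B) -> Cmod (v n) <= 1 ->
  Cmod (sumC (fun i => u i * v i)%C n) <= B * (1 + sumR (fun i => Cmod (v (S i) - v i)) n).
Proof.
  intros HU Hv. rewrite abel_summation. unfold Cminus at 1.
  assert (HB : 0 <= B) by (eapply Rle_trans; [apply Cmod_ge_0|apply (HU 0%nat); lia]).
  eapply Rle_trans; [apply Cmod_triangle|].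
  rewrite Cmod_opp, Cmod_mult, Rmult_plus_distr_l, <- sumR_scal.
  apply Rplus_le_compat.
  - apply Rmult_le_compat; [apply Cmod_ge_0|apply Cmod_ge_0|now apply HU|exact Hv].
  - eapply Rle_trans; [apply sumC_Cmod|]. apply sumR_le. intros i Hi. rewrite Cmod_mult.
    apply Rmult_le_compat_r; [apply Cmod_ge_0|apply HU; lia].
Qed.

Lemma Rpower_mvt (p x y : R) : 0 < x -> x < y ->
  exists z, x < z < y /\ Rpower y p - Rpower x p = p * Rpower z (p - 1) * (y - x).
Proof.
  intros Hx Hxy.
  destruct (MVT_cor2 (fun t => Rpower t p) (fun t => p * Rpower t (p - 1)) x y Hxy) as [z [H1 H2]].
  - intros t Ht. apply derivable_pt_lim_power. lra.
  - exists z. now split.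
Qed.

Lemma Rpower_pos (x p : R) : 0 < Rpower x p.
Proof. apply exp_pos. Qed.

Lemma Rpower_anti (x y p : R) : p <= 0 -> 0 < x <= y -> Rpower y p <= Rpower x p.
Proof.
  intros Hp Hxy. replace p with (- - p) by ring. rewrite !(Rpower_Ropp _ (- p)).
  apply Rinv_le_contravar; [apply Rpower_pos|]. apply Rle_Rpower_l; lra.
Qed.

Lemma Rpower_convex_diff (p x y : R) : 1 <= p -> 0 < x <= y ->
  p * Rpower x (p - 1) * (y - x) <= Rpower y p - Rpower x p <= p * Rpower y (p - 1) * (y - x).
Proof.
  intros Hp [Hx [Hxy|Hxy]].
  - destruct (Rpower_mvt p x y Hx Hxy) as [z [Hz E]]. rewrite E.
    split; (apply Rmult_le_compat_r; [lra|]); apply Rmult_le_compat_l; try lra;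
      apply Rle_Rpower_l; lra.
  - subst y. rewrite !Rminus_diag. lra.
Qed.

Lemma Rpower_concave_diff (p x y : R) : 0 <= p <= 1 -> 0 < x <= y ->
  p * Rpower y (p - 1) * (y - x) <= Rpower y p - Rpower x p <= p * Rpower x (p - 1) * (y - x).
Proof.
  intros Hp [Hx [Hxy|Hxy]].
  - destruct (Rpower_mvt p x y Hx Hxy) as [z [Hz E]]. rewrite E.
    split; (apply Rmult_le_compat_r; [lra|]); apply Rmult_le_compat_l; try lra;
      apply Rpower_anti; lra.
  - subst y. rewrite !Rminus_diag. lra.
Qed.

(** The phase is its tangent at [n0] plus a remainder [eps]. By convexity [eps] is nonnegative and
    nondecreasing, so the total variation of its character is controlled by its final value; partial
    summation reduces the sum to the geometric sums of the tangent. *)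
Lemma exp_block (c xi : R) (n0 K p n z : nat) : 1 < c < 2 -> (0 < n0)%nat -> (0 < K)%nat ->
  0 <= xi -> xi * (INR K ^ 2 * Rpower (INR n0) (c - 2)) <= 1 -> (p + n <= K)%nat ->
  Rabs (xi * (c * Rpower (INR n0) (c - 1)) - INR z) <= / 2 ->
  Cmod (sumC (fun r => e (xi * Rpower (INR (n0 + (p + r))) c)) n)
  <= 17 * cap (INR K) (Rabs (xi * (c * Rpower (INR n0) (c - 1)) - INR z)).
Proof.
  intros Hc Hn0 HK Hxi Hcurv Hpn Hz.
  set (al := c * Rpower (INR n0) (c - 1)) in *.
  set (eps := fun m : nat => Rpower (INR (n0 + m)) c - Rpower (INR n0) c - INR m * al).
  assert (Hn0r : 0 < INR n0) by (now apply lt_0_INR).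
  assert (Hmono : forall m, 0 <= eps (S m) - eps m).
  { intros m. unfold eps. rewrite S_INR, !plus_INR, S_INR. assert (Hm := pos_INR m).
    assert (H := proj1 (Rpower_convex_diff c (INR n0 + INR m) (INR n0 + (INR m + 1)) ltac:(lra) ltac:(lra))).
    assert (H1 : Rpower (INR n0) (c - 1) <= Rpower (INR n0 + INR m) (c - 1))
      by (apply Rle_Rpower_l; lra).
    unfold al. nra. }
  assert (Heps0 : forall m, 0 <= eps m).
  { induction m as [|m IH].
    - unfold eps. rewrite Nat.add_0_r. simpl. lra.
    - assert (H := Hmono m). lra. }
  assert (HepsK : xi * eps (p + n)%nat <= 2).
  { set (m := (p + n)%nat).
    assert (Hm := pos_INR m).
    assert (HmK : INR m <= INR K) by (now apply le_INR).
    assert (H1 := proj2 (Rpower_convex_diff c (INR n0) (INR n0 + INR m) ltac:(lra) ltac:(lra))).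
    assert (H2 := proj2 (Rpower_concave_diff (c - 1) (INR n0) (INR n0 + INR m) ltac:(lra) ltac:(lra))).
    replace (c - 1 - 1) with (c - 2) in H2 by ring.
    assert (H3 := Rpower_pos (INR n0) (c - 2)).
    replace (INR n0 + INR m - INR n0) with (INR m) in * by ring.
    (* Two applications of the mean value theorem produce the factor [c (c - 1) <= 2]. *)
    assert (He : eps m <= 2 * (INR K ^ 2 * Rpower (INR n0) (c - 2))).
    { unfold eps, al. rewrite plus_INR.
      apply Rle_trans with (c * INR m * (Rpower (INR n0 + INR m) (c - 1) - Rpower (INR n0) (c - 1))); [lra|].
      apply Rle_trans with (c * INR m * ((c - 1) * Rpower (INR n0) (c - 2) * INR m)).
      - apply Rmult_le_compat_l; [nra|exact H2].
      - replace (c * INR m * ((c - 1) * Rpower (INR n0) (c - 2) * INR m))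
          with ((c * (c - 1)) * (INR m ^ 2 * Rpower (INR n0) (c - 2))) by ring.
        assert (Hcc : 0 <= c * (c - 1) <= 2) by nra.
        assert (Hsq : INR m ^ 2 <= INR K ^ 2) by (apply pow_incr; lra).
        apply Rmult_le_compat; [lra| |lra|].
        + apply Rmult_le_pos; [apply pow2_ge_0|lra].
        + apply Rmult_le_compat_r; lra. }
    apply (Rmult_le_compat_l xi) in He; lra. }
  rewrite (sumC_ext _ (fun r =>
     (e (xi * (Rpower (INR n0) c + INR p * al)) * e (INR r * (xi * al)) * e (xi * eps (p + r)%nat)))%C).
  2:{ intros r _. rewrite <- !e_add. f_equal. unfold eps. rewrite (plus_INR p r). ring. }
  eapply Rle_trans.
  { apply (abel_bound (fun r => e (xi * (Rpower (INR n0) c + INR p * al)) * e (INR r * (xi * al)))%C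
       (fun r => e (xi * eps (p + r)%nat)) n (cap (INR K) (Rabs (xi * al - INR z)))).
    - intros m Hm. rewrite sumC_scal, Cmod_mult, Cmod_e, Rmult_1_l.
      apply geom_sum_cap; [exact HK|lia|exact Hz].
    - rewrite Cmod_e. lra. }
  rewrite Rmult_comm. apply Rmult_le_compat_r; [apply cap_ge0; now apply lt_0_INR|].
  assert (Hvar : sumR (fun i => Cmod (e (xi * eps (p + S i)%nat) - e (xi * eps (p + i)%nat))) n
     <= 2 * PI * xi * (eps (p + n)%nat - eps p)).
  { clear Hpn HepsK. induction n as [|n IH].
    - rewrite Nat.add_0_r. simpl. lra.
    - cbn [sumR]. assert (H := Cmod_e_sub (xi * eps (p + S n)%nat) (xi * eps (p + n)%nat)).
      rewrite <- Rmult_minus_distr_l, Rabs_mult, (Rabs_pos_eq xi) in H by exact Hxi.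
      rewrite Rabs_pos_eq in H by (rewrite Nat.add_succ_r; apply Hmono).
      rewrite <- Rmult_assoc in H. lra. }
  (* With [PI <= 4] and [xi eps <= 2] the variation is at most 16, hence the constant
     [17 = 1 + 16]. *)
  assert (Hp := Heps0 p). pose proof PI_4. pose proof PI_RGT_0.
  assert (xi * (eps (p + n)%nat - eps p) <= 2) by nra.
  nra.
Qed.

(** Summing over all candidate integers [z], not just the nearest one, frees [z] from [j], so that
    the blocks can be added for each [z] separately. For slopes at most [xi Y] the nearest integer
    is at most [floor (xi Y) + 1], which explains the double successor. *)
Definition block_bound (c Y : R) (A K : nat) (xi : R) (j : nat) : R :=
  17 * sumR (fun z => cap (INR K) (Rabs (xi * (c * Rpower (INR (A + 1 + j * K)) (c - 1)) - INR z)))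
    (S (S (floor_nat (xi * Y)))).

Lemma block_count (r : R) : 0 <= r -> INR (S (S (floor_nat r))) <= r + 2.
Proof. intros Hr. rewrite !S_INR. assert (H := floor_nat_spec r Hr). lra. Qed.

Lemma block_bound_valid (c Y xi : R) (A K J j p n : nat) :
  1 < c < 2 -> (0 < A)%nat -> (0 < K)%nat -> (j < J)%nat ->
  c * Rpower (INR (A + 1 + j * K)) (c - 1) <= Y -> 0 <= xi ->
  xi * (INR K ^ 2 * Rpower (INR A) (c - 2)) <= 1 -> (p + n <= K)%nat ->
  Cmod (sumC (fun r => e (xi * Rpower (INR (A + 1 + j * K + (p + r))) c)) n)
  <= block_bound c Y A K xi j.
Proof.
  intros Hc HA HK Hj HY Hxi Hcurv Hpn.
  assert (HAr : 0 < INR A) by (now apply lt_0_INR).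
  assert (HKr : 0 < INR K) by (now apply lt_0_INR).
  set (n0 := (A + 1 + j * K)%nat) in *.
  assert (Hn0 : INR A <= INR n0) by (apply le_INR; unfold n0; lia).
  assert (Hal : 0 <= c * Rpower (INR n0) (c - 1)).
  { apply Rmult_le_pos; [lra|apply Rlt_le, Rpower_pos]. }
  destruct (nearest_nat (xi * (c * Rpower (INR n0) (c - 1)))) as [z [Hz1 Hz2]].
  { now apply Rmult_le_pos. }
  eapply Rle_trans.
  { apply (exp_block c xi n0 K p n z Hc); [unfold n0; lia|exact HK|exact Hxi| |exact Hpn|exact Hz1].
    eapply Rle_trans; [|exact Hcurv]. apply Rmult_le_compat_l; [exact Hxi|].
    apply Rmult_le_compat_l; [apply pow2_ge_0|]. apply Rpower_anti; lra. }
  unfold block_bound. fold n0. apply Rmult_le_compat_l; [lra|].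
  apply (sumR_term_le (fun z => cap (INR K) (Rabs (xi * (c * Rpower (INR n0) (c - 1)) - INR z)))).
  - apply INR_lt. rewrite !S_INR.
    assert (H := Rmult_le_compat_l xi _ _ Hxi HY).
    assert (H1 := floor_nat_spec (xi * Y) ltac:(nra)). lra.
  - intros i _. now apply cap_ge0.
Qed.

Lemma block_bound_trivial (c Y xi : R) (A K J : nat) : (0 < K)%nat -> 0 <= xi * Y ->
  sumR (block_bound c Y A K xi) J <= 17 * (xi * Y + 2) * (INR J * INR K).
Proof.
  intros HK HY. assert (HKr : 0 < INR K) by (now apply lt_0_INR).
  apply Rle_trans with (INR J * (17 * ((xi * Y + 2) * INR K))); [|right; ring].
  apply sumR_bound. intros j _. unfold block_bound. apply Rmult_le_compat_l; [lra|].
  eapply Rle_trans; [apply sumR_bound; intros i _; now apply cap_le_K|].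
  apply Rmult_le_compat_r; [lra|]. now apply block_count.
Qed.

Lemma block_bound_sum (c Y xi d : R) (A K J : nat) : (0 < K)%nat -> 0 < xi -> 0 <= Y -> 0 < d ->
  (forall j, (S j < J)%nat ->
     d <= c * Rpower (INR (A + 1 + S j * K)) (c - 1) - c * Rpower (INR (A + 1 + j * K)) (c - 1)) ->
  sumR (block_bound c Y A K xi) J <= 34 * (xi * Y + 2) * (INR K + harmonic J / (xi * d)).
Proof.
  intros HK Hxi HY Hd Hsp. assert (HKr : 0 < INR K) by (now apply lt_0_INR).
  unfold block_bound. rewrite sumR_scal, sumR_swap.
  assert (HB : 0 <= 2 * (INR K + harmonic J / (xi * d))).
  { eapply Rle_trans; [|apply (spaced_sum (fun j => xi * (c * Rpower (INR (A + 1 + j * K)) (c - 1))) J (INR K) (xi * d) 0 HKr)].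
    - apply sumR_ge0. intros; now apply cap_ge0.
    - now apply Rmult_lt_0_compat.
    - intros j Hj. rewrite <- Rmult_minus_distr_l. apply Rmult_le_compat_l; [lra|now apply Hsp]. }
  apply Rle_trans with (17 * (INR (S (S (floor_nat (xi * Y)))) * (2 * (INR K + harmonic J / (xi * d))))).
  - apply Rmult_le_compat_l; [lra|]. apply sumR_bound. intros z _.
    apply (spaced_sum (fun j => xi * (c * Rpower (INR (A + 1 + j * K)) (c - 1)))).
    + exact HKr.
    + now apply Rmult_lt_0_compat.
    + intros j Hj. rewrite <- Rmult_minus_distr_l. apply Rmult_le_compat_l; [lra|now apply Hsp].
  - assert (Hc := block_count (xi * Y) ltac:(nra)).
    apply (Rmult_le_compat_r _ _ _ HB) in Hc. lra.
Qed.

(** [Y] bounds the derivative of [n^c] up to [4A], so [la] is large enough for one block to span at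
    most [2^la]; the condition on [mu] keeps the nonlinear part of the phase bounded at all
    frequencies up to [2^mu]. The second term of [B] comes from [Y / d], where [d] bounds from below
    the growth of the derivative between consecutive blocks. *)
Lemma dyadic_core (c : R) (A K J la mu nu k : nat) (len : nat -> nat) :
  1 < c < 2 -> (0 < A)%nat -> (0 < K)%nat -> (A + 1 + J * K <= 4 * A)%nat ->
  (J <= 2 ^ nu)%nat -> (k <= la)%nat ->
  c * Rpower (4 * INR A) (c - 1) * INR K <= 2 ^ la ->
  2 ^ mu * (INR K ^ 2 * Rpower (INR A) (c - 2)) <= 1 ->
  (forall j, (j < J)%nat -> (len j <= K)%nat) ->
  let Y := c * Rpower (4 * INR A) (c - 1) in
  let B := 102 * (2 ^ mu * Y * INR K + 4 * INR A * (INR nu + 1) / ((c - 1) * INR K)) in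
  let tiny := 51 * (INR J * INR K) * (4 * 2 ^ k / Y) ^ k in
  sumR (fun j => Rabs (sumR (fun r => psi (floor_nat (Rpower (INR (A + 1 + j * K + r)) c))) (len j))) J
  <= 4 * (INR mu + 1) * tm_rho ^ la * B + 2 * (2 ^ la * 2 ^ mu) * tiny
  + 384 * ((INR mu + 1) * (INR J * INR K) / 2 ^ mu + 2 * B).
Proof.
  intros Hc HA HK HJ4 HJ Hk Hla Hmu Hlen Y B tiny.
  assert (HAr : 1 <= INR A) by (apply (le_INR 1); lia).
  assert (HKr : 1 <= INR K) by (apply (le_INR 1); lia).
  assert (HJr := pos_INR J). assert (Hnu := pos_INR nu).
  assert (H1 := pow2_gt0 la). assert (H2 := pow2_gt0 mu).
  assert (HYp : 0 < Rpower (4 * INR A) (c - 1)) by apply Rpower_pos.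
  assert (HY1 : 1 <= Y).
  { unfold Y. assert (1 <= Rpower (4 * INR A) (c - 1)); [|nra].
    apply Rle_trans with (Rpower (4 * INR A) 0); [rewrite Rpower_O; lra|apply Rle_Rpower; lra]. }
  assert (Hpt : forall j r, (j < J)%nat -> (r <= K)%nat ->
     INR A <= INR (A + 1 + j * K + r) <= 4 * INR A).
  { intros j r Hj Hr. split; [apply le_INR; lia|].
    replace 4 with (INR 4) by (simpl; ring). rewrite <- mult_INR. apply le_INR. nia. }
  assert (Hharm : harmonic J <= INR nu + 1).
  { eapply Rle_trans; [|apply harmonic_pow2]. apply sumR_mono; [exact HJ|].
    intros. apply Rlt_le, Rinv_0_lt_compat, lt_0_INR. lia. }
  set (d := c * (c - 1) * Rpower (4 * INR A) (c - 2) * INR K).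
  assert (Hd : 0 < d).
  { unfold d. assert (Hp := Rpower_pos (4 * INR A) (c - 2)).
    repeat apply Rmult_lt_0_compat; lra. }
  assert (HYd : Y / d = 4 * INR A / ((c - 1) * INR K)).
  { unfold Y, d. replace (c - 1) with (c - 2 + 1) at 1 by ring.
    rewrite Rpower_plus, Rpower_1 by lra. field.
    assert (Hp := Rpower_pos (4 * INR A) (c - 2)). repeat split; lra. }
  assert (HB : 0 <= B).
  { unfold B. apply Rmult_le_pos; [lra|]. apply Rplus_le_le_0_compat.
    - apply Rmult_le_pos; [apply Rmult_le_pos|]; lra.
    - apply Rmult_le_pos; [apply Rmult_le_pos; lra|].
      apply Rlt_le, Rinv_0_lt_compat. nra. }
  assert (Htiny : 0 <= tiny).
  { unfold tiny. apply Rmult_le_pos; [nra|]. apply pow_le.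
    apply Rlt_le, Rdiv_lt_0_compat; [|lra]. pose proof (pow2_gt0 k). lra. }
  assert (Hsp : forall j, (S j < J)%nat ->
     d <= c * Rpower (INR (A + 1 + S j * K)) (c - 1) - c * Rpower (INR (A + 1 + j * K)) (c - 1)).
  { intros j Hj. assert (Ha := Hpt j 0%nat ltac:(lia) ltac:(lia)). rewrite Nat.add_0_r in Ha.
    assert (Hb := Hpt (S j) 0%nat ltac:(lia) ltac:(lia)). rewrite Nat.add_0_r in Hb.
    assert (Hstep : INR (A + 1 + S j * K) = INR (A + 1 + j * K) + INR K).
    { rewrite <- plus_INR. f_equal. lia. }
    assert (Hcc := proj1 (Rpower_concave_diff (c - 1) (INR (A + 1 + j * K)) (INR (A + 1 + S j * K))
       ltac:(lra) ltac:(lra))).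
    replace (c - 1 - 1) with (c - 2) in Hcc by ring.
    assert (Han := Rpower_anti (INR (A + 1 + S j * K)) (4 * INR A) (c - 2) ltac:(lra) ltac:(lra)).
    replace (INR (A + 1 + S j * K) - INR (A + 1 + j * K)) with (INR K) in Hcc by lra.
    unfold d. rewrite <- Rmult_minus_distr_l, !Rmult_assoc. apply Rmult_le_compat_l; [lra|].
    eapply Rle_trans; [|exact Hcc]. rewrite <- Rmult_assoc.
    apply Rmult_le_compat_r; [lra|]. apply Rmult_le_compat_l; lra. }
  assert (Hbig : forall xi, / Y <= xi -> xi <= 2 ^ mu -> sumR (block_bound c Y A K xi) J <= B).
  { intros xi Hx1 Hx2.
    assert (HxiY : 1 <= xi * Y).
    { apply (Rmult_le_compat_r Y) in Hx1; [|lra]. rewrite Rinv_l in Hx1 by lra. exact Hx1. }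
    assert (Hxi : 0 < xi) by (pose proof (Rinv_0_lt_compat Y ltac:(lra)); lra).
    eapply Rle_trans; [apply (block_bound_sum c Y xi d A K J HK Hxi ltac:(lra) Hd Hsp)|].
    assert (Hpos : 0 <= INR K + (INR nu + 1) / (xi * d)).
    { apply Rplus_le_le_0_compat; [lra|]. apply Rlt_le, Rdiv_lt_0_compat; [lra|nra]. }
    (* As [xi Y >= 1], the number of integers [xi Y + 2] is at most [3 xi Y]. Then [xi] cancels in
       [xi Y / (xi d)], and this makes the bound uniform; [102 = 34 * 3]. *)
    apply Rle_trans with (34 * (3 * (xi * Y)) * (INR K + (INR nu + 1) / (xi * d))).
    - apply Rle_trans with (34 * (xi * Y + 2) * (INR K + (INR nu + 1) / (xi * d))).
      + apply Rmult_le_compat_l; [lra|]. apply Rplus_le_compat_l.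
        apply Rmult_le_compat_r; [|exact Hharm]. apply Rlt_le, Rinv_0_lt_compat. nra.
      + apply Rmult_le_compat_r; [exact Hpos|lra].
    - replace (34 * (3 * (xi * Y)) * (INR K + (INR nu + 1) / (xi * d)))
        with (102 * (xi * (Y * INR K) + (Y / d) * (INR nu + 1))) by (field; lra).
      rewrite HYd. unfold B. apply Rmult_le_compat_l; [lra|].
      apply Rplus_le_compat.
      + rewrite Rmult_assoc. apply Rmult_le_compat_r; [nra|exact Hx2].
      + right. field. lra. }
  apply (psi_blocks_bound la mu K J (fun j r => Rpower (INR (A + 1 + j * K + r)) c)
           (block_bound c Y A K) len B tiny HB Htiny Hlen).
  - intros. apply Rlt_le, Rpower_pos.
  - intros j r s Hj Hrs Hs. apply Rle_Rpower_l; [lra|].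
    assert (Ha := Hpt j r Hj ltac:(lia)). split; [lra|]. apply le_INR. lia.
  - intros j r Hj Hr. rewrite Nat.add_0_r.
    assert (Ha := Hpt j 0%nat Hj ltac:(lia)). rewrite Nat.add_0_r in Ha.
    assert (Hb := Hpt j r Hj ltac:(lia)).
    assert (Hstep : INR (A + 1 + j * K + r) = INR (A + 1 + j * K) + INR r) by (rewrite <- plus_INR; reflexivity).
    assert (Hr0 := pos_INR r). assert (HrK : INR r <= INR K) by (apply le_INR; lia).
    assert (Hcx := proj2 (Rpower_convex_diff c (INR (A + 1 + j * K)) (INR (A + 1 + j * K + r))
       ltac:(lra) ltac:(lra))).
    assert (Hle : Rpower (INR (A + 1 + j * K + r)) (c - 1) <= Rpower (4 * INR A) (c - 1))
      by (apply Rle_Rpower_l; lra).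
    assert (Hp := Rpower_pos (INR (A + 1 + j * K + r)) (c - 1)).
    replace (INR (A + 1 + j * K + r) - INR (A + 1 + j * K)) with (INR r) in Hcx by lra.
    assert (c * Rpower (INR (A + 1 + j * K + r)) (c - 1) * INR r <= c * Rpower (4 * INR A) (c - 1) * INR K); [|lra].
    apply Rmult_le_compat; [nra|lra| |lra]. apply Rmult_le_compat_l; lra.
  - intros xi j p n Hxi Hj Hpn. apply (block_bound_valid c Y xi A K J j p n Hc HA HK Hj).
    + assert (Ha := Hpt j 0%nat Hj ltac:(lia)). rewrite Nat.add_0_r in Ha.
      unfold Y. apply Rmult_le_compat_l; [lra|]. apply Rle_Rpower_l; lra.
    + lra.
    + eapply Rle_trans; [|exact Hmu]. apply Rmult_le_compat_r; [|lra].
      apply Rmult_le_pos; [apply pow2_ge_0|apply Rlt_le, Rpower_pos].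
    + exact Hpn.
  - intros xi Hxi. assert (HP := tmP_ge0 la xi).
    destruct (Rle_dec (/ Y) xi) as [Hc1|Hc1].
    + assert (Hb := Hbig xi Hc1 (proj2 Hxi)).
      apply (Rmult_le_compat_l _ _ _ HP) in Hb. lra.
    (* Below [1 / Y] the slopes are too close together. The trivial bound [17 * 3] per point is
       multiplied by a product with [k] small factors. *)
    + assert (HxY : xi * Y <= 1).
      { apply Rnot_le_lt, Rlt_le in Hc1. apply (Rmult_le_compat_r Y) in Hc1; [|lra]. rewrite Rinv_l in Hc1; lra. }
      assert (HxY0 : 0 <= xi * Y) by nra.
      assert (Ht := block_bound_trivial c Y xi A K J HK HxY0).
      assert (Hs := tmP_small k la xi Hk (proj1 Hxi)).
      assert (Hpw : (4 * 2 ^ k * xi) ^ k <= (4 * 2 ^ k / Y) ^ k).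
      { apply pow_incr. assert (Hp := pow2_gt0 k). split; [nra|].
        apply Rmult_le_compat_l; [lra|].
        apply Rmult_le_reg_r with Y; [lra|]. rewrite Rinv_l; lra. }
      assert (HJK : 0 <= INR J * INR K) by nra.
      assert (Ht2 : sumR (block_bound c Y A K xi) J <= 51 * (INR J * INR K)).
      { eapply Rle_trans; [exact Ht|]. apply Rmult_le_compat_r; lra. }
      assert (0 <= tmP la xi * B) by nra.
      assert (tmP la xi * sumR (block_bound c Y A K xi) J <= tiny); [|lra].
      unfold tiny. rewrite (Rmult_comm (51 * _)).
      apply Rle_trans with (tmP la xi * (51 * (INR J * INR K))).
      * now apply Rmult_le_compat_l.
      * apply Rmult_le_compat_r; lra.
  - intros xi Hxi. apply Hbig; [|lra].
    apply Rle_trans with 1; [|lra]. rewrite <- Rinv_1. apply Rinv_le_contravar; lra.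
Qed.

(** * Choice of the parameters *)

(** The last block is cut to the remainder, possibly empty. It still occupies [K] places, so that
    all blocks have equally spaced starting points. *)
Lemma sum_blocks (f : nat -> R) (K M : nat) : (0 < K)%nat ->
  Rabs (sumR f M) <=
  sumR (fun j => Rabs (sumR (fun r => f (j * K + r)%nat) (if Nat.ltb j (M / K) then K else M mod K)))
    (S (M / K)).
Proof.
  intros HK. rewrite (Nat.div_mod_eq M K) at 1. rewrite (Nat.mul_comm K), sumR_app.
  eapply Rle_trans; [apply Rabs_triang|]. cbn [sumR]. rewrite Nat.ltb_irrefl.
  apply Rplus_le_compat_r. rewrite sumR_block. eapply Rle_trans; [apply sumR_Rabs|].
  apply sumR_le. intros j Hj. apply Nat.ltb_lt in Hj. rewrite Hj. lra.
Qed.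

Lemma pow2_below (r : R) : 1 <= r -> exists n : nat, 2 ^ n <= r < 2 * 2 ^ n.
Proof.
  intros Hr. destruct (Pow_x_infinity 2 ltac:(rewrite Rabs_pos_eq; lra) (r + 1)) as [N HN].
  assert (HN1 := HN N (le_n N)). rewrite Rabs_pos_eq in HN1 by (apply pow_le; lra).
  clear HN. induction N as [|N IH]; [simpl in HN1; lra|].
  destruct (Rle_dec (2 ^ N) r) as [H|H].
  - exists N. simpl in HN1. lra.
  - destruct (Rle_dec (r + 1) (2 ^ N)) as [H0|H0]; [apply IH; lra|].
    clear IH HN1. assert (Hc : forall m, r < 2 ^ m -> exists n : nat, 2 ^ n <= r < 2 * 2 ^ n).
    { induction m as [|m IHm]; intros Hm; [simpl in Hm; lra|].
      destruct (Rle_dec (2 ^ m) r) as [H1|H1]; [exists m; simpl in Hm; lra|apply IHm; lra]. }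
    apply (Hc N). lra.
Qed.

Lemma pow2_above (r : R) : 1 <= r -> exists n : nat, r <= 2 ^ n <= 2 * r.
Proof. intros Hr. destruct (pow2_below r Hr) as [n Hn]. exists (S n). simpl. lra. Qed.

Lemma ln2_pos : 0 < ln 2.
Proof. rewrite <- ln_1. apply ln_increasing; lra. Qed.

(** [1 + t <= exp t] at [t = n ep ln 2]. The slack 8 serves both logarithms: [2^mu <= y] and
    [2^nu <= 6 y]. *)
Lemma log2_le_Rpower (ep y : R) (n : nat) : 0 < ep <= 1 -> 1 <= y -> 2 ^ n <= 8 * y ->
  INR n + 1 <= 8 * (/ (ep * ln 2) + 1) * Rpower y ep.
Proof.
  intros Hep Hy Hn. assert (Hl := ln2_pos). assert (Hn0 := pos_INR n).
  assert (H1 : 1 + INR n * (ep * ln 2) <= Rpower (2 ^ n) ep).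
  { rewrite <- Rpower_pow by lra. rewrite Rpower_mult. unfold Rpower.
    replace (INR n * ep * ln 2) with (INR n * (ep * ln 2)) by ring.
    apply exp_ineq1_le. }
  assert (H2 : Rpower (2 ^ n) ep <= Rpower (8 * y) ep).
  { apply Rle_Rpower_l; [lra|]. pose proof (pow2_gt0 n). lra. }
  rewrite <- Rpower_mult_distr in H2 by lra.
  assert (H3 : Rpower 8 ep <= 8).
  { rewrite <- (Rpower_1 8) at 2 by lra. apply Rle_Rpower; lra. }
  assert (Hp : 0 < Rpower y ep) by apply Rpower_pos.
  assert (H4 : 1 + INR n * (ep * ln 2) <= 8 * Rpower y ep) by nra.
  set (q := ep * ln 2) in *. assert (Hq : 0 < q) by (unfold q; nra).
  assert (Hq' : 0 < / q) by (now apply Rinv_0_lt_compat).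
  assert (H5 : INR n <= / q * (8 * Rpower y ep)).
  { replace (INR n) with (/ q * (INR n * q)) by (field; lra). apply Rmult_le_compat_l; lra. }
  assert (0 <= INR n * q) by nra. lra.
Qed.

Definition tm_exponent : R := ln tm_rho / ln 2.

Lemma tm_rho_pow (n : nat) : tm_rho ^ n = Rpower (2 ^ n) tm_exponent.
Proof.
  assert (Hl := ln2_pos).
  rewrite <- (Rpower_pow n 2), Rpower_mult by lra.
  rewrite <- (Rpower_pow n tm_rho) by (unfold tm_rho; lra).
  unfold Rpower, tm_exponent. f_equal. field. lra.
Qed.

(** The rational comparison [tm_rho ^ 32 < 2 ^ 13] avoids numerical logarithms. The value 13/32 =
    0.40625 lies below 0.4076 and satisfies [(1 + 13/32) * 1.42 < 2], as the range of [c] in the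
    second claim demands. *)
Lemma tm_exponent_bounds : 0 <= tm_exponent < 13 / 32.
Proof.
  assert (Hl := ln2_pos). unfold tm_exponent.
  assert (H0 : 0 <= ln tm_rho) by (rewrite <- ln_1; apply ln_le; unfold tm_rho; lra).
  split.
  - apply Rmult_le_pos; [exact H0|]. now apply Rlt_le, Rinv_0_lt_compat.
  - apply Rmult_lt_reg_r with (ln 2); [exact Hl|]. unfold Rdiv at 1.
    rewrite Rmult_assoc, Rinv_l by lra.
    assert (H : ln (tm_rho ^ 32) < ln (2 ^ 13)).
    { apply ln_increasing; [apply pow_lt; unfold tm_rho; lra|].
      unfold tm_rho. replace (1325 / 1000) with (53 / 40) by field. simpl. lra. }
    rewrite !ln_pow in H by (unfold tm_rho; lra). simpl INR in H. lra.
Qed.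

Lemma Rpower_ge1 (y s : R) : 1 <= y -> 0 <= s -> 1 <= Rpower y s.
Proof.
  intros Hy Hs. apply Rle_trans with (Rpower y 0); [rewrite Rpower_O; lra|now apply Rle_Rpower].
Qed.

(* [e1 - eta = 2 ep] pays for the two logarithms, each of which is [O (y^ep)]. *)
Lemma tm_dyadic_large (c eta e1 ka ep : R) (k : nat) :
  1 < c < 2 -> 0 < eta -> 0 < ep <= 1 -> e1 = eta + 2 * ep ->
  ka = (2 - c - e1) / 2 -> tm_exponent * (c - 1 + ka) - ka + e1 <= 0 ->
  2 <= INR k * (c - 1) ->
  exists C, forall A M : nat, (2 <= A)%nat -> 2 ^ k <= Rpower (INR A) (c - 1) -> (M <= A + 1)%nat ->
  Rabs (sumR (fun i => psi (floor_nat (Rpower (INR (A + 1 + i)) c))) M) <= C * Rpower (INR A) (1 - eta).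
Proof.
  intros Hc Heta Hep He1 Hka Hexp Hk. assert (Ha := tm_exponent_bounds).
  set (a := tm_exponent) in *.
  (* The exponent hypothesis reads [(1 - a) ka >= a (c - 1) + e1], which yields both this and the
     next inequality. *)
  assert (Hkap : 0 < ka) by nra.
  assert (Hke : e1 <= ka) by nra.
  set (C1 := 8 * (/ (ep * ln 2) + 1)).
  assert (HC1 : 0 < C1).
  { unfold C1. assert (0 < / (ep * ln 2)); [|lra].
    apply Rinv_0_lt_compat, Rmult_lt_0_compat; [lra|apply ln2_pos]. }
  set (CB := 102 * (8 + 8 * C1 / (c - 1))).
  assert (HCB : 0 < CB).
  { unfold CB. assert (0 < 8 * C1 / (c - 1)); [|lra]. apply Rdiv_lt_0_compat; lra. }
  set (Ck := (4 * 2 ^ k) ^ k).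
  assert (HCk : 0 < Ck) by (apply pow_lt; pose proof (pow2_gt0 k); lra).
  (* One summand for each of [T1] to [T4] below: [64 = 4 * 16], [4896 = 2 * 16 * 51 * 3],
     [2304 = 384 * 3 * 2], [768 = 384 * 2]. *)
  exists (64 * C1 * CB + 4896 * Ck + 2304 * C1 + 768 * CB).
  intros A M HA HAk HM.
  set (y := INR A) in *.
  assert (Hy : 2 <= y) by (apply (le_INR 2); exact HA).
  set (p := Rpower y) in *.
  assert (pp : forall s, 0 < p s) by (intros; apply Rpower_pos).
  assert (pm : forall s t, p s * p t = p (s + t)) by (intros; symmetry; apply Rpower_plus).
  assert (pl : forall s t, s <= t -> p s <= p t) by (intros; apply Rle_Rpower; lra).
  assert (p1 : p 1 = y) by (apply Rpower_1; lra).
  assert (pge : forall s, 0 <= s -> 1 <= p s) by (intros; apply Rpower_ge1; lra).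
  set (K := floor_nat (p ka)).
  assert (Hpk1 := pge ka ltac:(lra)).
  assert (HKs := floor_nat_spec (p ka) ltac:(lra)). fold K in HKs.
  assert (HK : (0 < K)%nat).
  { apply INR_lt. change (INR 0) with 0. lra. }
  assert (HK1 : 1 <= INR K) by (apply (le_INR 1); lia).
  assert (HK2 : p ka / 2 <= INR K <= p ka) by lra.
  assert (HKA : (K <= A)%nat).
  { apply INR_le. fold y. rewrite <- p1. apply Rle_trans with (p ka); [lra|]. apply pl. lra. }
  set (J := S (M / K)).
  assert (HJK : (J * K <= M + K)%nat).
  { unfold J. assert (H := Nat.div_mod_eq M K). nia. }
  (* The blocks overshoot the segment by at most [K <= A], so they end by [3A + 2], which is at most
     [4A] as [A >= 2]. *)
  assert (HJ4 : (A + 1 + J * K <= 4 * A)%nat) by lia.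
  assert (HJKr : INR J * INR K <= 3 * y).
  { unfold y. rewrite <- mult_INR. replace 3 with (INR 3) by (simpl; ring).
    rewrite <- mult_INR. apply le_INR. lia. }
  assert (HJKr0 : 0 <= INR J * INR K) by (rewrite <- mult_INR; apply pos_INR).
  assert (HJ1 : 1 <= INR J) by (apply (le_INR 1); unfold J; lia).
  assert (HJy : INR J <= 3 * y) by nra.
  destruct (pow2_above (INR J) HJ1) as [nu Hnu].
  destruct (pow2_below (p e1) (pge e1 ltac:(lra))) as [mu Hmu].
  set (Y := c * Rpower (4 * y) (c - 1)).
  assert (H4c : 1 <= Rpower 4 (c - 1) <= 4).
  { split; [apply Rpower_ge1; lra|]. rewrite <- (Rpower_1 4) at 2 by lra. apply Rle_Rpower; lra. }
  assert (HYe : Rpower (4 * y) (c - 1) = Rpower 4 (c - 1) * p (c - 1)).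
  { unfold p. rewrite <- Rpower_mult_distr by lra. reflexivity. }
  assert (Hpc := pp (c - 1)). assert (Hpc1 := pge (c - 1) ltac:(lra)).
  assert (HY : p (c - 1) <= Y <= 8 * p (c - 1)).
  { unfold Y. rewrite HYe. split.
    - assert (1 <= c * Rpower 4 (c - 1)) by nra. nra.
    - assert (c * Rpower 4 (c - 1) <= 8) by nra. nra. }
  destruct (pow2_above (Y * INR K)) as [la Hla]; [nra|].
  assert (Hkla : (k <= la)%nat).
  { destruct (Nat.le_gt_cases k la) as [H|H]; [exact H|]. exfalso.
    assert (H1 : 2 ^ S la <= 2 ^ k) by (apply Rle_pow; [lra|lia]). simpl in H1.
    assert (H2 := pow2_gt0 la). nra. }
  assert (Hpka := pp ka).
  assert (HlaU : 2 ^ la <= 16 * p (c - 1 + ka)).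
  { rewrite <- pm. assert (Y * INR K <= 8 * p (c - 1) * p ka); [|lra].
    apply Rmult_le_compat; lra. }
  assert (HmuU : 2 ^ mu <= 8 * y).
  { apply Rle_trans with (p e1); [lra|]. apply Rle_trans with (p 1); [apply pl; lra|lra]. }
  assert (Hlmu := log2_le_Rpower ep y mu Hep ltac:(lra) HmuU).
  assert (Hlnu := log2_le_Rpower ep y nu Hep ltac:(lra) ltac:(lra)).
  fold C1 in Hlmu, Hlnu. change (Rpower y ep) with (p ep) in Hlmu, Hlnu.
  (* The choice of [ka] makes the exponent [e1 + 2 ka + c - 2] vanish exactly. *)
  assert (Hcurv : 2 ^ mu * (INR K ^ 2 * Rpower (INR A) (c - 2)) <= 1).
  { fold y. change (Rpower y (c - 2)) with (p (c - 2)).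
    apply Rle_trans with (p e1 * (p ka ^ 2 * p (c - 2))).
    - assert (H2 := pow2_gt0 mu). assert (H3 := pp (c - 2)).
      apply Rmult_le_compat; [lra| |lra|].
      + apply Rmult_le_pos; [apply pow2_ge_0|lra].
      + apply Rmult_le_compat_r; [lra|]. apply pow_incr. lra.
    - simpl. rewrite Rmult_1_r, !pm. right. unfold p. rewrite <- (Rpower_O y) by lra.
      f_equal. lra. }
  assert (Hcore := dyadic_core c A K J la mu nu k
    (fun j => if Nat.ltb j (M / K) then K else (M mod K)%nat) Hc ltac:(lia) HK HJ4).
  cbv zeta in Hcore. fold y in Hcore. fold Y in Hcore.
  specialize (Hcore ltac:(apply INR_le; rewrite INR_pow2; lra) Hkla (proj1 Hla) Hcurv).
  assert (Hlen : forall j, (j < J)%nat -> ((if Nat.ltb j (M / K) then K else M mod K) <= K)%nat).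
  { intros j _. destruct (Nat.ltb j (M / K)); [lia|].
    apply Nat.lt_le_incl, Nat.mod_upper_bound. lia. }
  specialize (Hcore Hlen).
  eapply Rle_trans; [apply (sum_blocks _ K M HK)|].
  eapply Rle_trans; [|eapply Rle_trans; [exact Hcore|]].
  { right. fold J. apply sumR_ext. intros j _. f_equal. apply sumR_ext. intros r _.
    do 4 f_equal. lia. }
  clear Hcore Hlen.
  set (B := 102 * (2 ^ mu * Y * INR K + 4 * y * (INR nu + 1) / ((c - 1) * INR K))).
  assert (Hnu0 := pos_INR nu). assert (Hmu0 := pos_INR mu).
  assert (H2mu := pow2_gt0 mu). assert (H2la := pow2_gt0 la).
  assert (HB : B <= CB * p (1 - ka + ep)).
  (* By the same relation [e1 + (c - 1) + ka = 1 - ka]: both terms of [B] have the size of the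
     number of blocks, up to a logarithm. *)
  { assert (HB1 : 2 ^ mu * Y * INR K <= 8 * p (1 - ka + ep)).
    { apply Rle_trans with (p e1 * (8 * p (c - 1)) * p ka).
      - apply Rmult_le_compat; [nra|lra| |lra]. apply Rmult_le_compat; lra.
      - replace (p e1 * (8 * p (c - 1)) * p ka) with (8 * (p e1 * p (c - 1) * p ka)) by ring.
        rewrite !pm. apply Rmult_le_compat_l; [lra|]. apply pl. lra. }
    assert (HB2 : 4 * y * (INR nu + 1) / ((c - 1) * INR K) <= 8 * C1 / (c - 1) * p (1 - ka + ep)).
    { apply Rle_trans with (4 * y * (C1 * p ep) / ((c - 1) * (p ka / 2))).
      - unfold Rdiv at 1 2. apply Rmult_le_compat.
        + nra.
        + apply Rlt_le, Rinv_0_lt_compat. nra.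
        + apply Rmult_le_compat_l; lra.
        + apply Rinv_le_contravar; [nra|]. apply Rmult_le_compat_l; lra.
      - right. replace (p (1 - ka + ep)) with (y * p ep / p ka).
        + field. lra.
        + rewrite <- p1 at 1. rewrite pm.
          replace (1 + ep) with (1 - ka + ep + ka) by ring. rewrite <- pm. field. lra. }
    unfold B, CB. lra. }
  assert (HB0 : 0 <= B).
  { unfold B. apply Rmult_le_pos; [lra|]. apply Rplus_le_le_0_compat.
    - apply Rmult_le_pos; [apply Rmult_le_pos|]; lra.
    - apply Rmult_le_pos; [nra|]. apply Rlt_le, Rinv_0_lt_compat. nra. }
  assert (Hpe := pp (1 - eta)). assert (Hpep := pp ep).
  (* The main term. The exponent hypothesis enters here, with [e1 = eta + 2 ep] absorbing one [ep]
     from [mu] and one from [B]. *)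
  assert (T1 : 4 * (INR mu + 1) * tm_rho ^ la * B <= 64 * C1 * CB * p (1 - eta)).
  { assert (Hrho : tm_rho ^ la <= 16 * p (a * (c - 1 + ka))).
    { rewrite tm_rho_pow. fold a.
      apply Rle_trans with (Rpower (16 * p (c - 1 + ka)) a).
      - apply Rle_Rpower_l; lra.
      - rewrite <- Rpower_mult_distr by (lra || apply pp).
        unfold p at 1. rewrite Rpower_mult. rewrite (Rmult_comm (c - 1 + ka)).
        fold (p (a * (c - 1 + ka))). apply Rmult_le_compat_r; [apply Rlt_le, pp|].
        rewrite <- (Rpower_1 16) at 2 by lra. apply Rle_Rpower; lra. }
    assert (Hr0 : 0 <= tm_rho ^ la) by (apply pow_le; unfold tm_rho; lra).
    apply Rle_trans with (4 * (C1 * p ep) * (16 * p (a * (c - 1 + ka))) * (CB * p (1 - ka + ep))).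
    - apply Rmult_le_compat; [|exact HB0| |exact HB].
      + apply Rmult_le_pos; [lra|exact Hr0].
      + apply Rmult_le_compat; [lra|exact Hr0|lra|exact Hrho].
    - replace (4 * (C1 * p ep) * (16 * p (a * (c - 1 + ka))) * (CB * p (1 - ka + ep)))
        with (64 * C1 * CB * (p ep * p (a * (c - 1 + ka)) * p (1 - ka + ep))) by ring.
      rewrite !pm. apply Rmult_le_compat_l; [nra|]. apply pl. lra. }
  assert (T2 : 2 * (2 ^ la * 2 ^ mu) * (51 * (INR J * INR K) * (4 * 2 ^ k / Y) ^ k)
               <= 4896 * Ck * p (1 - eta)).
  (* [k (c - 1) >= 2] gives the saving [y^-2], enough against the number of frequencies times the
     number of points. *)
  { assert (Hsm : (4 * 2 ^ k / Y) ^ k <= Ck * p (-2)).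
    { unfold Rdiv. rewrite Rpow_mult_distr. fold Ck. apply Rmult_le_compat_l; [lra|].
      rewrite pow_inv. unfold p. change (-2) with (Ropp 2). rewrite Rpower_Ropp.
      apply Rinv_le_contravar; [apply Rpower_pos|].
      apply Rle_trans with (p (c - 1) ^ k); [|apply pow_incr; lra].
      rewrite <- Rpower_pow by exact Hpc. unfold p. rewrite Rpower_mult.
      apply Rle_Rpower; [lra|]. lra. }
    assert (Hsm0 : 0 <= (4 * 2 ^ k / Y) ^ k).
    { apply pow_le. apply Rlt_le, Rdiv_lt_0_compat; [|lra]. pose proof (pow2_gt0 k). lra. }
    apply Rle_trans with (2 * (16 * p (c - 1 + ka) * p e1) * (51 * (3 * y) * (Ck * p (-2)))).
    - apply Rmult_le_compat.
      + nra.
      + apply Rmult_le_pos; [lra|exact Hsm0].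
      + apply Rmult_le_compat_l; [lra|]. apply Rmult_le_compat; lra.
      + apply Rmult_le_compat; [lra|exact Hsm0|lra|exact Hsm].
    - rewrite <- p1.
      replace (2 * (16 * p (c - 1 + ka) * p e1) * (51 * (3 * p 1) * (Ck * p (-2))))
        with (4896 * Ck * (p (c - 1 + ka) * p e1 * p 1 * p (-2))) by ring.
      rewrite !pm. apply Rmult_le_compat_l; [lra|]. apply pl. lra. }
  assert (T3 : 384 * ((INR mu + 1) * (INR J * INR K) / 2 ^ mu) <= 2304 * C1 * p (1 - eta)).
  { apply Rle_trans with (384 * ((C1 * p ep) * (3 * y) / (p e1 / 2))).
    - apply Rmult_le_compat_l; [lra|]. assert (Hpe1 := pp e1).
      unfold Rdiv at 1 2. apply Rmult_le_compat.
      + nra.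
      + apply Rlt_le, Rinv_0_lt_compat. lra.
      + apply Rmult_le_compat; lra.
      + apply Rinv_le_contravar; lra.
    - assert (Hpe1 := pp e1).
      replace (384 * (C1 * p ep * (3 * y) / (p e1 / 2))) with (2304 * C1 * (p ep * y / p e1))
        by (field; lra).
      apply Rmult_le_compat_l; [lra|]. apply Rmult_le_reg_r with (p e1); [exact Hpe1|].
      unfold Rdiv. rewrite Rmult_assoc, Rinv_l, Rmult_1_r by lra.
      rewrite <- p1, !pm. apply pl. lra. }
  assert (T4 : 768 * B <= 768 * CB * p (1 - eta)).
  { rewrite Rmult_assoc. apply Rmult_le_compat_l; [lra|].
    eapply Rle_trans; [exact HB|]. apply Rmult_le_compat_l; [lra|]. apply pl. nra. }
  lra.
Qed.

(** * From dyadic segments to all [N] *)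

Lemma tm_sum_add (c : R) (A M : nat) :
  tm_sum c (A + M) = tm_sum c A + sumR (fun i => psi (floor_nat (Rpower (INR (A + 1 + i)) c))) M.
Proof.
  induction M as [|M IH].
  - rewrite Nat.add_0_r. simpl. ring.
  - rewrite Nat.add_succ_r. cbn [tm_sum sumR]. rewrite IH. unfold tm_term, psi.
    replace (A + 1 + M)%nat with (S (A + M)) by lia. ring.
Qed.

Lemma tm_dyadic (c eta : R) : 1 < c < 2 -> 0 < eta ->
  eta < (2 - (tm_exponent + 1) * c) / (3 - tm_exponent) ->
  eta < 1 /\
  exists C, 0 <= C /\ forall A M : nat, (1 <= A)%nat -> (M <= A + 1)%nat ->
  Rabs (sumR (fun i => psi (floor_nat (Rpower (INR (A + 1 + i)) c))) M) <= C * Rpower (INR A) (1 - eta).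
Proof.
  intros Hc Heta Hlt. assert (Ha := tm_exponent_bounds). set (a := tm_exponent) in *.
  set (thr := (2 - (a + 1) * c) / (3 - a)) in *.
  assert (Hthr : thr * (3 - a) = 2 - (a + 1) * c) by (unfold thr; field; lra).
  assert (Hthr1 : thr < 1) by nra.
  split; [lra|].
  (* This puts [e1 = eta + 2 ep] midway between [eta] and the critical exponent [thr]. *)
  set (ep := (thr - eta) / 4).
  destruct (INR_unbounded (2 / (c - 1))) as [k Hk].
  assert (Hk' : 2 <= INR k * (c - 1)).
  { apply Rlt_le. apply (Rmult_lt_compat_r (c - 1)) in Hk; [|lra].
    unfold Rdiv in Hk. rewrite Rmult_assoc, Rinv_l in Hk by lra. lra. }
  set (e1 := eta + 2 * ep).
  assert (He1 : e1 <= thr) by (unfold e1, ep; lra).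
  destruct (tm_dyadic_large c eta e1 ((2 - c - e1) / 2) ep k Hc Heta) as [C HC].
  - unfold ep. lra.
  - reflexivity.
  - reflexivity.
  - fold a. assert (e1 * (3 - a) <= thr * (3 - a)) by (apply Rmult_le_compat_r; lra). lra.
  - exact Hk'.
  (* From [A0] on, [A^(c-1)] exceeds [2^k]; the finitely many smaller [A] go into the constant, each
     sum being at most [A0 + 1]. *)
  - destruct (INR_unbounded (Rpower (2 ^ k) (/ (c - 1)) + 2)) as [A0 HA0].
    assert (Hpk := Rpower_pos (2 ^ k) (/ (c - 1))).
    exists (Rabs C + (INR A0 + 1)). assert (HC0 := Rabs_pos C). assert (HA00 := pos_INR A0).
    split; [lra|]. intros A M HA HM.
    assert (HAr : 1 <= INR A) by (apply (le_INR 1); exact HA).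
    assert (Hp := Rpower_ge1 (INR A) (1 - eta) HAr ltac:(lra)).
    destruct (Nat.le_gt_cases A0 A) as [H|H].
    + apply le_INR in H.
      apply Rle_trans with (C * Rpower (INR A) (1 - eta)).
      * apply HC; [apply INR_le; simpl; lra| |exact HM].
        replace (2 ^ k) with (Rpower (Rpower (2 ^ k) (/ (c - 1))) (c - 1)).
        -- apply Rle_Rpower_l; lra.
        -- rewrite Rpower_mult, Rinv_l, Rpower_1 by (lra || apply pow2_gt0). reflexivity.
      * assert (H1 := Rle_abs C). apply Rmult_le_compat_r; lra.
    + apply lt_INR in H.
      apply Rle_trans with (INR M).
      * eapply Rle_trans; [apply sumR_Rabs|]. rewrite <- (Rmult_1_r (INR M)).
        apply sumR_bound. intros. rewrite Rabs_psi. lra.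
      * apply le_INR in HM. rewrite plus_INR in HM. simpl in HM. nra.
Qed.

(** Strong induction by halving. With [A = N / 2] rounded down, the remaining length [N - A] can be
    [A + 1], which is why segments of that length are allowed throughout. *)
Lemma dyadic_sum_bound (S : nat -> R) (s C : R) : 0 < s -> 0 <= C ->
  Rabs (S 0%nat) <= 1 -> Rabs (S 1%nat) <= 1 ->
  (forall A M : nat, (1 <= A)%nat -> (M <= A + 1)%nat ->
     Rabs (S (A + M)%nat - S A) <= C * Rpower (INR A) s) ->
  exists C', forall N : nat, (1 <= N)%nat -> Rabs (S N) <= C' * Rpower (INR N) s.
Proof.
  intros Hs HC H0 H1 Hdy.
  set (q := Rpower (/ 2) s).
  assert (Hq : 0 < q < 1).
  { split; [apply Rpower_pos|]. unfold q, Rpower. rewrite <- exp_0. apply exp_increasing.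
    assert (ln (/ 2) < 0) by (rewrite <- ln_1; apply ln_increasing; lra). nra. }
  (* The sum of the geometric series in [q = 2^-s], chosen so that [(C + C') q <= C']; the summand 1
     covers [N = 1]. *)
  set (C' := 1 + C * q / (1 - q)).
  assert (HC' : 1 <= C').
  { unfold C'. assert (0 <= C * q / (1 - q)); [|lra]. apply Rmult_le_pos; [nra|].
    apply Rlt_le, Rinv_0_lt_compat. lra. }
  assert (HCq : (C + C') * q <= C').
  { assert (C' * (1 - q) = 1 - q + C * q) by (unfold C'; field; lra). lra. }
  exists C'. intros N. induction N as [N IH] using lt_wf_ind. intros HN.
  destruct (Nat.eq_dec N 1) as [E|E].
  - subst N. simpl INR. unfold Rpower. rewrite ln_1, Rmult_0_r, exp_0. lra.
  - set (A := (N / 2)%nat).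
    assert (HA2 := Nat.div_mod_eq N 2). fold A in HA2.
    assert (HA3 := Nat.mod_upper_bound N 2 ltac:(lia)).
    assert (HA : (1 <= A)%nat) by lia.
    assert (Hd := Hdy A (N - A)%nat HA ltac:(lia)).
    replace (A + (N - A))%nat with N in Hd by lia.
    assert (Hi := IH A ltac:(lia) HA).
    assert (HAr : 0 < INR A) by (apply lt_0_INR; lia).
    assert (HAN : INR A <= / 2 * INR N).
    { assert (H : INR (2 * A) <= INR N) by (apply le_INR; lia).
      rewrite mult_INR in H. simpl INR in H. lra. }
    assert (Hp : Rpower (INR A) s <= q * Rpower (INR N) s).
    { unfold q. rewrite Rpower_mult_distr by lra. apply Rle_Rpower_l; lra. }
    assert (Htri : Rabs (S N) <= Rabs (S N - S A) + Rabs (S A)).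
    { replace (S N) with (S N - S A + S A) at 1 by ring. apply Rabs_triang. }
    assert (HpN := Rpower_pos (INR N) s).
    apply Rle_trans with ((C + C') * Rpower (INR A) s); [lra|].
    apply Rle_trans with ((C + C') * (q * Rpower (INR N) s)).
    + apply Rmult_le_compat_l; lra.
    + rewrite <- Rmult_assoc. apply Rmult_le_compat_r; lra.
Qed.

Lemma tm_sum_bound (c eta : R) : 1 < c < 2 -> 0 < eta ->
  eta < (2 - (tm_exponent + 1) * c) / (3 - tm_exponent) ->
  exists C : R, forall N : nat, (2 <= N)%nat ->
    / INR N * Rabs (tm_sum c N) <= C * Rpower (INR N) (- eta).
Proof.
  intros Hc Heta Hlt. destruct (tm_dyadic c eta Hc Heta Hlt) as [Heta1 [C [HC Hdy]]].
  destruct (dyadic_sum_bound (tm_sum c) (1 - eta) C) as [C' HC'].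
  - lra.
  - exact HC.
  - simpl. rewrite Rabs_R0. lra.
  - simpl tm_sum. rewrite Rplus_0_l. unfold tm_term. rewrite pow_1_abs. lra.
  - intros A M HA HM. rewrite tm_sum_add.
    match goal with |- Rabs (?u + ?v - ?u) <= _ => replace (u + v - u) with v by ring end.
    now apply Hdy.
  - exists C'. intros N HN. assert (HNr : 0 < INR N) by (apply lt_0_INR; lia).
    assert (H := HC' N ltac:(lia)).
    replace (1 - eta) with (1 + - eta) in H by ring.
    rewrite Rpower_plus, Rpower_1 in H by exact HNr.
    apply Rmult_le_reg_l with (INR N); [exact HNr|].
    rewrite <- Rmult_assoc, Rinv_r, Rmult_1_l by lra. lra.
Qed.

Theorem theorem2 :
  (exists a : R, 0 <= a /\ a < 4076 / 10000 /\
     forall c eta : R, 1 < c -> c < 2 ->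
       0 < eta -> eta < (2 - (a + 1) * c) / (3 - a) ->
       exists C : R, forall N : nat, (2 <= N)%nat ->
         / INR N * Rabs (tm_sum c N) <= C * Rpower (INR N) (- eta))
  /\
  (forall c : R, 1 < c -> c <= 142 / 100 ->
     exists eta C : R, Rmax 0 ((7 - 5 * c) / 9) < eta /\
       forall N : nat, (2 <= N)%nat ->
         / INR N * Rabs (tm_sum c N) <= C * Rpower (INR N) (- eta)).
Proof.
  assert (Ha := tm_exponent_bounds). split.
  - exists tm_exponent. split; [lra|]. split; [lra|].
    intros c eta H1 H2 H3 H4. now apply tm_sum_bound.
  - intros c H1 H2. set (a := tm_exponent) in *.
    set (thr := (2 - (a + 1) * c) / (3 - a)).
    (* The threshold decreases in [a] when [c > 1/2], and at [a = 13/32] it is [(64 - 45 c) / 83].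
       This is positive for [c <= 1.42] and exceeds [(7 - 5 c) / 9] as soon as [c > 1/2]. *)
    assert (Hthr : Rmax 0 ((7 - 5 * c) / 9) < thr).
    { assert (E : thr * (3 - a) = 2 - (a + 1) * c) by (unfold thr; field; lra).
      apply Rmax_lub_lt; (apply Rmult_lt_reg_r with (3 - a); [lra|]); rewrite E; nra. }
    set (m := Rmax 0 ((7 - 5 * c) / 9)) in *.
    assert (Hm : 0 <= m) by apply Rmax_l.
    destruct (tm_sum_bound c ((m + thr) / 2)) as [C HC]; [lra|lra|fold a; fold thr; lra|].
    exists ((m + thr) / 2), C. split; [lra|exact HC].
Qed.
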